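(* Let $\Psi$ be a context of parameters with positive types and $A$ a negative type, and consider $\langle\mathrm{Pat}_A(\Psi),\cup,\cap,\mathrm{Not},\mathbf 1,\mathbf 0\rangle$. For all $\mathcal M,\mathcal N,\mathcal P\in\mathrm{Pat}_A(\Psi)$: (1) $\mathcal M\cap\mathcal M\simeq\mathcal M$; (2) $\mathcal M\cap\mathcal N\simeq\mathcal N\cap\mathcal M$; (3) $\mathcal M\cap(\mathcal N\cup\mathcal P)\simeq(\mathcal M\cap\mathcal N)\cup(\mathcal M\cap\mathcal P)$; (4) $\mathcal M\cap(\mathcal N\cap\mathcal P)\simeq(\mathcal M\cap\mathcal N)\cap\mathcal P$; (5) $\mathrm{Not}(\mathrm{Not}(\mathcal M))\simeq\mathcal M$; (6) $\mathrm{Not}(\mathbf 1)\simeq\mathbf 0$; (7) $\mathrm{Not}(\mathbf 0)\simeq\mathbf 1$.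
   Context: Strict $\lambda$-calculus over a signature $\Sigma$: labels $k\in\{1,0,u\}$; types $A::=a\mid A_1\to^kA_2$; terms $c\mid x\mid\lambda x^k{:}A.M\mid M_1M_2^k$. Typing $\Gamma;\Omega;\Delta\vdash M:A$ (disjoint unrestricted/irrelevant/strict contexts): $c{:}A\in\Sigma$ gives $\Gamma;\Omega;\cdot\vdash c:A$; $(\Gamma,x{:}A);\Omega;\cdot\vdash x:A$; $\Gamma;\Omega;x{:}A\vdash x:A$ (no rule for $\Omega$); $\lambda x^u,\lambda x^0,\lambda x^1$ typed at $A\to^uB,A\to^0B,A\to^1B$ from the body with $x{:}A$ added to $\Gamma,\Omega,\Delta$ respectively; $MN^u:B$ from $\Gamma;\Omega;\Delta\vdash M:A\to^uB$ and $(\Gamma,\Delta);\Omega;\cdot\vdash N:A$; $MN^0:B$ from $\Gamma;\Omega;\Delta\vdash M:A\to^0B$ and $(\Gamma,\Omega,\Delta);\cdot;\cdot\vdash N:A$; $\Gamma;\Omega;(\Delta_M,\Delta_N)\vdash MN^1:B$ from $(\Gamma,\Delta_N);\Omega;\Delta_M\vdash M:A\to^1B$ and $(\Gamma,\Delta_M);\Omega;\Delta_N\vdash N:A$. Simple patterns: positive $P::=a\mid N\to^1P$, negative $N::=a\mid P\to^uN$ types; $\Sigma,\Psi$ declare positive types. For $\Psi=x_1{:}A_1,\dots,x_n{:}A_n$ (fixed order), $\Phi=x_1^{k_1}\dots x_n^{k_n}$, $\Phi(x_i)=k_i$, $\Psi^u$ all labels $u$; $\Gamma;\Omega;\Delta\vdash\Phi\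 ok$ iff $\Gamma,\Omega,\Delta$ partition $\Psi$ with $x$ in $\Gamma/\Omega/\Delta$ iff $\Phi(x)=u/0/1$. Generalized variable $E\,\Phi$ of atomic type $a$, $E{:}A_1\to^{k_1}\cdots A_n\to^{k_n}a$. $\Psi\vdash M\Uparrow A$: $\lambda x^u{:}P.M\Uparrow P\to^uB$ if $(\Psi,x{:}P)\vdash M\Uparrow B$; $h\,M_1^1\dots M_n^1\Uparrow a$ for $h\in\mathrm{dom}(\Sigma\cup\Psi)$ of type $A_1\to^1\cdots\to^1A_n\to^1a$ with $M_i\Uparrow A_i$; $E\,\Phi\Uparrow a$. Linear: no existential variable twice; closed: none. Convention: fresh $Z\,\Phi$ at non-atomic type $B_1\to^u\cdots\to^uB_m\to^ua$ means $\lambda y_1^u{:}B_1\dots\lambda y_m^u{:}B_m.Z\,\Phi\,y_1^u\dots y_m^u$. Ground instances for closed $M$: if $\Gamma;\Omega;\Delta\vdash\Phi\ ok$ and $\Gamma;\Omega;\Delta\vdash M:a$ then $\Psi\vdash M\in\|E\Phi\|:a$; $\lambda x^u{:}A.M\in\|\lambda x^u{:}A.N\|$ if $(\Psi,x{:}A)\vdash M\in\|N\|$; $h\,M_1^1\dots M_n^1\in\|h\,N_1^1\dots N_n^1\|$ if $h\in\Sigma\cup\Psi$ and $M_i\in\|N_i\|$. For a set $\mathcal N$: $\|\mathcal N\|$ is the set of closed $M$ with $\Psi\vdash M\Uparrow A$ and $M\in\|N\|$ for some $N\in\mathcal N$. Complement $\mathrm{Not}(N)$ of a single pattern: set of all $Q$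 with $\Psi\vdash\mathrm{Not}(N)\Rightarrow Q:A$, where ($Z$'s fresh; $\mathrm{Not}(1)=0,\mathrm{Not}(0)=1,\mathrm{Not}(u)=u$; $\mathrm{Not}_i(\Phi)$ defined when $\Phi(x_i)\in\{0,1\}$, labelling $x_i$ by $\mathrm{Not}(\Phi(x_i))$ and all others $u$): $\mathrm{Not}(E\Phi)\Rightarrow Z\,\mathrm{Not}_i(\Phi)$; $\mathrm{Not}(\lambda x^u{:}A.M)\Rightarrow\lambda x^u{:}A.N$ if $(\Psi,x{:}A)\vdash\mathrm{Not}(M)\Rightarrow N$; for $h{:}A_1\to^1\cdots\to^1A_n\to^1a$ in $\Sigma\cup\Psi$: $\mathrm{Not}(h\,M_1^1\dots M_n^1)\Rightarrow g(Z_1\Psi^u)^1\dots(Z_m\Psi^u)^1$ for any $g\ne h$ in $\Sigma\cup\Psi$ of type $A'_1\to^1\cdots\to^1A'_m\to^1a$, and $\Rightarrow h(Z_1\Psi^u)^1\dots(Z_{i-1}\Psi^u)^1N^1(Z_{i+1}\Psi^u)^1\dots(Z_n\Psi^u)^1$ whenever $\Psi\vdash\mathrm{Not}(M_i)\Rightarrow N:A_i$. Intersection $M\cap N$ of two patterns (renamed apart): set of all $Q$ with $\Psi\vdash M\cap N\Rightarrow Q:A$, where (label intersection $1\cap1=u\cap1=1\cap u=1$, $0\cap0=u\cap0=0\cap u=0$, $u\cap u=u$, otherwise undefined, pointwise on sequences; $H$'s fresh): $(E_1\Phi_1)\cap(E_2\Phi_2)\Rightarrow H(\Phi_1\cap\Phi_2)$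 when defined; $(E\Phi)\cap(c\,M_1^1\dots M_n^1)\Rightarrow c\,N_1^1\dots N_n^1$ if $c{:}A_1\to^1\cdots\to^1A_n\to^1a\in\Sigma$ and $(H_i\Phi_i)\cap M_i\Rightarrow N_i:A_i$ for all $i$, where $\Phi(x)=0\Rightarrow$ all $\Phi_i(x)=0$, $\Phi(x)=u\Rightarrow$ all $\Phi_i(x)=u$, $\Phi(x)=1\Rightarrow$ exactly one $\Phi_i(x)=1$ and the others $u$; the same with a head $y\in\mathrm{dom}\Psi$ except that the $1$-clause is only for $x\ne y$ and $\Phi(y)=1\Rightarrow$ all $\Phi_i(y)=u$; symmetric versions with the flexible pattern on the right; $(h\,M_1^1\dots M_n^1)\cap(h\,N_1^1\dots N_n^1)\Rightarrow h\,Q_1^1\dots Q_n^1$ if $M_i\cap N_i\Rightarrow Q_i$; $(\lambda x^u{:}A.M)\cap(\lambda x^u{:}A.N)\Rightarrow\lambda x^u{:}A.Q$ if $(\Psi,x{:}A)\vdash M\cap N\Rightarrow Q$. Algebra: $\mathrm{Pat}_A(\Psi)$ is the collection of finite sets of simple linear patterns of type $A$ over $\Psi$. For sets: $\mathcal M\cap\mathcal N=\bigcup_{M\in\mathcal M,N\in\mathcal N}M\cap N$; $\mathrm{Not}(\mathcal M)=\bigcap_{M\in\mathcal M}\mathrm{Not}(M)$ (iterated set intersection as just defined, the empty intersection being $\mathbf 1$); $\cup$ is set-theoretic union. $\mathcal N_1\simeq\mathcal N_2$ iff $\|\mathcal N_1\|=\|\mathcal N_2\|$. $\mathbf 0=\emptyset$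 and $\mathbf 1=\{\lambda x_1^u{:}A_1\dots\lambda x_n^u{:}A_n.\,E\,\Psi^u\,x_1^u\dots x_n^u\}$ where $A=A_1\to^u\cdots\to^uA_n\to^ua$.
   Formalization: The rule for (E Φ) ∩ (y M_1…M_n) with y a parameter (and its mirror image) is applied only when Φ(y) is 1 or u, not 0; read literally, associativity (4) fails for Ψ = y:a, {E y^1}, {F y^0}, {y}. *)

(* Defs.v *)
From HB Require Import structures.
From mathcomp Require Import all_boot.
From mathcomp Require Import boolp classical_sets.

Set Implicit Arguments.
Unset Strict Implicit.
Unset Printing Implicit Defensive.

Local Open Scope classical_set_scope.

(* k1 = strict, k0 = irrelevant, ku = unrestricted *)
Inductive label := k1 | k0 | ku.

Inductive ty :=
| Atom of nat
| Arr of ty & label & ty.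

HB.instance Definition _ := gen_eqMixin ty.
HB.instance Definition _ := gen_choiceMixin ty.

Fixpoint positive (A : ty) : bool :=
  match A with
  | Atom _ => true
  | Arr N k1 P => negative N && positive P
  | Arr _ _ _ => false
  end
with negative (A : ty) : bool :=
  match A with
  | Atom _ => true
  | Arr P ku N => positive P && negative N
  | Arr _ _ _ => false
  end.

(* A_1 ->^1 ... ->^1 A_n ->^1 a *)
Definition arrows1 (As : seq ty) (a : nat) : ty :=
  foldr (fun A B => Arr A k1 B) (Atom a) As.

(* Existential variables carry their type; there are infinitely many of each
   type. *)
Definition exvar : Type := (nat * ty)%type.

(* Variables are de Bruijn indices; constants are positions in the signature.
   [Flex E Phi] is the generalized variable E x_1^{k_1} ... x_n^{k_n} applied
   to all the parameters in scope. Contexts, and the label sequences Phi, list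
   the most recently bound variable x_n first. *)
Inductive tm :=
| Cst of nat
| Var of nat
| Lam of label & ty & tm
| App of tm & tm & label
| Flex of exvar & seq label.

HB.instance Definition _ := gen_eqMixin tm.
HB.instance Definition _ := gen_choiceMixin tm.

Fixpoint evars (M : tm) : seq exvar :=
  match M with
  | Cst _ | Var _ => [::]
  | Lam _ _ M => evars M
  | App M N _ => evars M ++ evars N
  | Flex E _ => [:: E]
  end.

Definition closed (M : tm) : Prop := evars M = [::].

Definition linear_tm (M : tm) : bool := uniq (evars M).

Definition apart (M N : tm) : bool := ~~ has (mem (evars M)) (evars N).

Fixpoint rename (r : exvar -> exvar) (M : tm) : tm :=
  match M with
  | Cst c => Cst c
  | Var x => Var x
  | Lam k A M => Lam k A (rename r M)
  | App M N k => App (rename r M) (rename r N) k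
  | Flex E Phi => Flex (r E) Phi
  end.

Definition renaming (M N : tm) : Prop :=
  exists r : exvar -> exvar,
    [/\ forall E, (r E).2 = E.2, {in evars M &, injective r} & N = rename r M].

(** Typing of the strict lambda-calculus *)

(* The three disjoint zones Gamma; Omega; Delta are one context whose
   declarations are labelled by their zone: ku, k0 and k1 respectively. *)
Definition lctx : Type := seq (label * ty).

Definition no_strict (G : lctx) : Prop :=
  forall x A, onth G x <> Some (k1, A).

(* (Gamma, Delta); Omega; . *)
Definition loosen (G : lctx) : lctx :=
  [seq (if d.1 is k1 then ku else d.1, d.2) | d <- G].

(* (Gamma, Omega, Delta); .; . *)
Definition loosen_all (G : lctx) : lctx := [seq (ku, d.2) | d <- G].

(* [split_ctx G GM GN]: with G = Gamma; Omega; (Delta_M, Delta_N), GM is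
   (Gamma, Delta_N); Omega; Delta_M and GN is (Gamma, Delta_M); Omega; Delta_N. *)
Inductive split_ctx : lctx -> lctx -> lctx -> Prop :=
| split_nil : split_ctx [::] [::] [::]
| split_u A G GM GN :
    split_ctx G GM GN -> split_ctx ((ku, A) :: G) ((ku, A) :: GM) ((ku, A) :: GN)
| split_0 A G GM GN :
    split_ctx G GM GN -> split_ctx ((k0, A) :: G) ((k0, A) :: GM) ((k0, A) :: GN)
| split_1l A G GM GN :
    split_ctx G GM GN -> split_ctx ((k1, A) :: G) ((k1, A) :: GM) ((ku, A) :: GN)
| split_1r A G GM GN :
    split_ctx G GM GN -> split_ctx ((k1, A) :: G) ((ku, A) :: GM) ((k1, A) :: GN).

Inductive typed (Sg : seq ty) : lctx -> tm -> ty -> Prop :=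
| ty_cst G c A :
    onth Sg c = Some A -> no_strict G -> typed Sg G (Cst c) A
| ty_uvar G x A :
    onth G x = Some (ku, A) -> no_strict G -> typed Sg G (Var x) A
| ty_svar G x A :
    onth G x = Some (k1, A) ->
    (forall y B, onth G y = Some (k1, B) -> y = x) ->
    typed Sg G (Var x) A
| ty_lam G k A M B :
    typed Sg ((k, A) :: G) M B -> typed Sg G (Lam k A M) (Arr A k B)
| ty_app_u G M N A B :
    typed Sg G M (Arr A ku B) -> typed Sg (loosen G) N A ->
    typed Sg G (App M N ku) B
| ty_app_0 G M N A B :
    typed Sg G M (Arr A k0 B) -> typed Sg (loosen_all G) N A ->
    typed Sg G (App M N k0) B
| ty_app_1 G GM GN M N A B :
    split_ctx G GM GN ->
    typed Sg GM M (Arr A k1 B) -> typed Sg GN N A ->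
    typed Sg G (App M N k1) B.

(** Simple patterns *)

Inductive hd :=
| HCst of nat
| HVar of nat.

Definition head_tm (h : hd) : tm :=
  match h with HCst c => Cst c | HVar x => Var x end.

Definition head_ty (Sg Psi : seq ty) (h : hd) : option ty :=
  match h with HCst c => onth Sg c | HVar x => onth Psi x end.

(* h M_1^1 ... M_n^1 *)
Definition spine (h : hd) (Ms : seq tm) : tm :=
  foldl (fun M N => App M N k1) (head_tm h) Ms.

(* A_1 ->^{k_1} ... A_n ->^{k_n} a, with x_n : A_n at the front of Psi *)
Definition flex_ty (Psi : seq ty) (Phi : seq label) (a : nat) : ty :=
  foldl (fun B d => Arr d.2 d.1 B) (Atom a) (zip Phi Psi).

Definition all_u (Psi : seq ty) : seq label := nseq (size Psi) ku.

(* The generalized variable Z Phi at a negative type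
   A = B_1 ->^u ... ->^u B_m ->^u a, where z is the name of Z: the eta-long form
   \y_1^u:B_1 ... \y_m^u:B_m. Z Phi y_1^u ... y_m^u *)
Fixpoint genvar (z : nat) (Psi : seq ty) (Phi : seq label) (A : ty) : tm :=
  match A with
  | Atom a => Flex (z, flex_ty Psi Phi a) Phi
  | Arr B _ C => Lam ku B (genvar z (B :: Psi) (ku :: Phi) C)
  end.

(* Default values for out-of-range accesses that never happen *)
Notation nth_tm := (nth (Var 0)).
Notation nth_ty := (nth (Atom 0)).

(* Psi |- M \Uparrow A, the well-formedness judgment for simple patterns *)
Inductive pattern (Sg : seq ty) : seq ty -> tm -> ty -> Prop :=
| pat_lam Psi P M B :
    positive P -> pattern Sg (P :: Psi) M B ->
    pattern Sg Psi (Lam ku P M) (Arr P ku B)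
| pat_rigid Psi h As a Ms :
    head_ty Sg Psi h = Some (arrows1 As a) -> size Ms = size As ->
    (forall i, i < size As -> pattern Sg Psi (nth_tm Ms i) (nth_ty As i)) ->
    pattern Sg Psi (spine h Ms) (Atom a)
| pat_flex Psi E Phi a :
    size Phi = size Psi -> E.2 = flex_ty Psi Phi a ->
    pattern Sg Psi (Flex E Phi) (Atom a).

(* Psi |- M \in || N || : A. In the flexible rule the context Gamma; Omega; Delta
   with Gamma; Omega; Delta |- Phi ok is [zip Phi Psi]. *)
Inductive ground_inst (Sg : seq ty) : seq ty -> tm -> tm -> ty -> Prop :=
| inst_flex Psi E Phi a M :
    size Phi = size Psi -> closed M -> typed Sg (zip Phi Psi) M (Atom a) ->
    ground_inst Sg Psi M (Flex E Phi) (Atom a)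
| inst_lam Psi A B M N :
    ground_inst Sg (A :: Psi) M N B ->
    ground_inst Sg Psi (Lam ku A M) (Lam ku A N) (Arr A ku B)
| inst_rigid Psi h As a Ms Ns :
    head_ty Sg Psi h = Some (arrows1 As a) ->
    size Ms = size As -> size Ns = size As ->
    (forall i, i < size As ->
       ground_inst Sg Psi (nth_tm Ms i) (nth_tm Ns i) (nth_ty As i)) ->
    ground_inst Sg Psi (spine h Ms) (spine h Ns) (Atom a).

Definition ground (Sg Psi : seq ty) (A : ty) (NN : set tm) : set tm :=
  [set M | [/\ closed M, pattern Sg Psi M A &
             exists2 N, NN N & ground_inst Sg Psi M N A]].

(** Complement of a single pattern *)

Definition not_label (k : label) : label :=
  match k with k1 => k0 | k0 => k1 | ku => ku end.

Definition not_at (i : nat) (Phi : seq label) : seq label :=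
  mkseq (fun j => if j == i then not_label (nth ku Phi i) else ku) (size Phi).

(* (Z_1 Psi^u), ..., (Z_n Psi^u) at types A_1, ..., A_n *)
Definition genvars_u (Z : nat -> nat) (Psi : seq ty) (As : seq ty) : seq tm :=
  mkseq (fun i => genvar (Z i) Psi (all_u Psi) (nth_ty As i)) (size As).

(* Psi |- Not(M) => Q : A, for arbitrary names of the new existential variables;
   their freshness is imposed on the final Q in [Not_pat]. *)
Inductive complement (Sg : seq ty) : seq ty -> tm -> tm -> ty -> Prop :=
| not_flex Psi E Phi a i Z :
    size Phi = size Psi -> i < size Phi -> nth ku Phi i <> ku ->
    complement Sg Psi (Flex E Phi) (genvar Z Psi (not_at i Phi) (Atom a))
      (Atom a)
| not_lam Psi A B M N :
    complement Sg (A :: Psi) M N B ->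
    complement Sg Psi (Lam ku A M) (Lam ku A N) (Arr A ku B)
| not_head Psi h g As As' a Ms Z :
    head_ty Sg Psi h = Some (arrows1 As a) -> size Ms = size As ->
    head_ty Sg Psi g = Some (arrows1 As' a) -> g <> h ->
    complement Sg Psi (spine h Ms) (spine g (genvars_u Z Psi As')) (Atom a)
| not_arg Psi h As a Ms i N Z :
    head_ty Sg Psi h = Some (arrows1 As a) -> size Ms = size As ->
    i < size As -> complement Sg Psi (nth_tm Ms i) N (nth_ty As i) ->
    complement Sg Psi (spine h Ms)
      (spine h (set_nth (Var 0) (genvars_u Z Psi As) i N)) (Atom a).

Definition Not_pat (Sg Psi : seq ty) (A : ty) (M : tm) : set tm :=
  [set Q | [/\ complement Sg Psi M Q A, linear_tm Q & apart Q M]].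

(** Intersection of two patterns *)

Definition cap_label (k k' : label) : option label :=
  match k, k' with
  | k1, k1 | ku, k1 | k1, ku => Some k1
  | k0, k0 | ku, k0 | k0, ku => Some k0
  | ku, ku => Some ku
  | k1, k0 | k0, k1 => None
  end.

(* Phi1 \cap Phi2 is defined and equal to Phi *)
Definition cap_labels (Phi1 Phi2 Phi : seq label) : Prop :=
  size Phi1 = size Phi2 /\
  [seq cap_label d.1 d.2 | d <- zip Phi1 Phi2] = map Some Phi.

(* How Phi is distributed as Phi_1, ..., Phi_n over the n arguments of the head
   h. The condition h <> HVar x in the irrelevant case says that a parameter
   irrelevant in Phi cannot be the head of an instance of E Phi. *)
Definition distribute (h : hd) (n : nat) (Phi : seq label)
    (Phis : nat -> seq label) : Prop :=
  (forall i, i < n -> size (Phis i) = size Phi) /\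
  forall x, x < size Phi ->
    match nth ku Phi x with
    | k0 => h <> HVar x /\ (forall i, i < n -> nth ku (Phis i) x = k0)
    | ku => forall i, i < n -> nth ku (Phis i) x = ku
    | k1 =>
        (h = HVar x -> forall i, i < n -> nth ku (Phis i) x = ku) /\
        (h <> HVar x ->
           exists i, [/\ i < n, nth ku (Phis i) x = k1 &
             forall j, j < n -> j <> i -> nth ku (Phis j) x = ku])
    end.

(* Psi |- M \cap N => Q : A, for arbitrary names of the new existential
   variables; their freshness is imposed on the final Q in [cap_pat]. *)
Inductive intersection (Sg : seq ty) : seq ty -> tm -> tm -> tm -> ty -> Prop :=
| cap_flex_flex Psi E1 E2 Phi1 Phi2 Phi a H :
    size Phi1 = size Psi -> cap_labels Phi1 Phi2 Phi ->
    intersection Sg Psi (Flex E1 Phi1) (Flex E2 Phi2)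
      (genvar H Psi Phi (Atom a)) (Atom a)
| cap_flex_rigid Psi E Phi h As a Ms Ns H Phis :
    size Phi = size Psi ->
    head_ty Sg Psi h = Some (arrows1 As a) ->
    size Ms = size As -> size Ns = size As ->
    distribute h (size As) Phi Phis ->
    (forall i, i < size As ->
       intersection Sg Psi (genvar (H i) Psi (Phis i) (nth_ty As i))
         (nth_tm Ms i) (nth_tm Ns i) (nth_ty As i)) ->
    intersection Sg Psi (Flex E Phi) (spine h Ms) (spine h Ns) (Atom a)
| cap_rigid_flex Psi E Phi h As a Ms Ns H Phis :
    size Phi = size Psi ->
    head_ty Sg Psi h = Some (arrows1 As a) ->
    size Ms = size As -> size Ns = size As ->
    distribute h (size As) Phi Phis ->
    (forall i, i < size As ->
       intersection Sg Psi (nth_tm Ms i)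
         (genvar (H i) Psi (Phis i) (nth_ty As i))
         (nth_tm Ns i) (nth_ty As i)) ->
    intersection Sg Psi (spine h Ms) (Flex E Phi) (spine h Ns) (Atom a)
| cap_rigid_rigid Psi h As a Ms Ns Qs :
    head_ty Sg Psi h = Some (arrows1 As a) ->
    size Ms = size As -> size Ns = size As -> size Qs = size As ->
    (forall i, i < size As ->
       intersection Sg Psi (nth_tm Ms i) (nth_tm Ns i) (nth_tm Qs i)
         (nth_ty As i)) ->
    intersection Sg Psi (spine h Ms) (spine h Ns) (spine h Qs) (Atom a)
| cap_lam Psi A B M N Q :
    intersection Sg (A :: Psi) M N Q B ->
    intersection Sg Psi (Lam ku A M) (Lam ku A N) (Lam ku A Q) (Arr A ku B).

(* M and N are renamed apart to M' and N' before being intersected. *)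
Definition cap_pat (Sg Psi : seq ty) (A : ty) (M N : tm) : set tm :=
  [set Q | exists M' N',
     [/\ renaming M M', renaming N N' & apart M' N'] /\
     [/\ intersection Sg Psi M' N' Q A, linear_tm Q, apart Q M' & apart Q N']].

(** The algebra of sets of linear patterns *)

(* s lists the elements of MM up to renaming of existential variables. *)
Definition enumerates (s : seq tm) (MM : set tm) : Prop :=
  (forall M, M \in s -> MM M) /\
  (forall M, MM M -> exists2 N, N \in s & renaming N M).

(* Since fresh variables may be chosen in infinitely many ways, finiteness is
   up to renaming of existential variables. *)
Definition Pat (Sg Psi : seq ty) (A : ty) (MM : set tm) : Prop :=
  (forall M, MM M -> pattern Sg Psi M A /\ linear_tm M) /\
  exists s, enumerates s MM.

Definition pat_zero : set tm := set0.

Definition pat_one (Psi : seq ty) (A : ty) : set tm :=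
  [set genvar 0 Psi (all_u Psi) A].

Definition pat_cap (Sg Psi : seq ty) (A : ty) (MM NN : set tm) : set tm :=
  \bigcup_(M in MM) \bigcup_(N in NN) cap_pat Sg Psi A M N.

Definition enumeration (MM : set tm) : seq tm :=
  xget [::] [set s | enumerates s MM].

Definition pat_Not (Sg Psi : seq ty) (A : ty) (MM : set tm) : set tm :=
  \big[pat_cap Sg Psi A/pat_one Psi A]_(M <- enumeration MM) Not_pat Sg Psi A M.

Definition pat_equiv (Sg Psi : seq ty) (A : ty) (MM NN : set tm) : Prop :=
  ground Sg Psi A MM = ground Sg Psi A NN.

(* Main.v *)
From mathcomp Require Import all_boot.
From mathcomp Require Import boolp classical_sets.
Require Import Defs.

(* A closed pattern is built with strict applications and unrestricted
   abstractions only, so it is typable in the zones Gamma; Omega; Delta given by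
   Phi iff every parameter labelled 1 occurs in it and no parameter labelled 0
   does. Hence the instances of E Phi are cut out by occurrence conditions,
   intersection denotes set intersection, and Not denotes the complement in the
   set of closed patterns; the laws become Boolean identities of sets.

   Not of a set is an intersection along an enumeration, so Not (Not M) also
   needs Not M to be finite up to renaming. Patterns of bounded application
   depth have finitely many skeletons (terms with the names of existential
   variables erased), intersection and complement keep the depth bounded, and
   two linear patterns with the same skeleton are renamings of each other. *)

Set Implicit Arguments.
Unset Strict Implicit.
Unset Printing Implicit Defensive.

Local Open Scope classical_set_scope.

(** Finite choice: it gathers witnesses found separately for each argument of a head into one
    argument list. *)
Lemma seq_choice T (x0 : T) n (R : nat -> T -> Prop) :
  (forall i, i < n -> exists x, R i x) ->
  exists2 s, size s = n & forall i, i < n -> R i (nth x0 s i).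
Proof.
elim: n R => [|n IHn] R RE; first by exists [::].
have [x Rx] := RE 0 isT.
have [s szs Rs] := IHn (fun i => R i.+1) (fun i => RE i.+1).
by exists (x :: s) => [|[|i] lti] //=; [rewrite szs | apply: Rs].
Qed.

(** * Spines *)

Definition is_var (x : nat) (h : hd) : bool := if h is HVar y then x == y else false.

Lemma is_varP x h : reflect (h = HVar x) (is_var x h).
Proof.
case: h => [c|y] /=; first by constructor.
by apply: (iffP eqP) => [->|[]].
Qed.

Lemma spine_rcons h Ms M : spine h (rcons Ms M) = App (spine h Ms) M k1.
Proof. by rewrite /spine foldl_rcons. Qed.

Lemma spine_inj h h' Ms Ms' : spine h Ms = spine h' Ms' -> h = h' /\ Ms = Ms'.
Proof.
elim/last_ind: Ms Ms' => [|Ms M IH] Ms'; case/lastP: Ms' => [|Ms' M'];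
  rewrite ?spine_rcons.
- by case: h h' => [c|x] [c'|x'] //= [->].
- by case: h.
- by case: h' {IH}.
by case=> /IH [-> ->] ->.
Qed.

Lemma spine_Lam h Ms k A M : spine h Ms <> Lam k A M.
Proof. by case/lastP: Ms => [|Ms N]; rewrite ?spine_rcons //; case: h. Qed.

Lemma spine_Flex h Ms E Phi : spine h Ms <> Flex E Phi.
Proof. by case/lastP: Ms => [|Ms N]; rewrite ?spine_rcons //; case: h. Qed.

Lemma arrows1_inj As As' a a' :
  arrows1 As a = arrows1 As' a' -> As = As' /\ a = a'.
Proof. by elim: As As' => [|A As IH] [|A' As'] //= [] // -> /IH[-> ->]. Qed.

Lemma evars_spine h Ms : evars (spine h Ms) = flatten (map evars Ms).
Proof.
elim/last_ind: Ms => [|Ms M IH]; first by case: h.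
by rewrite spine_rcons /= IH map_rcons -cats1 flatten_cat /= cats0.
Qed.

Lemma closed_spine h Ms i :
  closed (spine h Ms) -> i < size Ms -> closed (nth_tm Ms i).
Proof.
rewrite /closed evars_spine; elim: Ms i => //= M Ms IH i.
by move=> /eqP; rewrite -size_eq0 size_cat addn_eq0 !size_eq0 => /andP[/eqP e1 /eqP e2];
  case: i => //= i; apply: IH.
Qed.

(** Closedness excludes flexible patterns and passes to subterms, so only abstractions and rigid
    terms remain, with closed immediate subterms. *)
Lemma pattern_closed_ind Sg (P : seq ty -> tm -> ty -> Prop) :
  (forall Psi A M B, positive A -> pattern Sg (A :: Psi) M B -> closed M ->
     P (A :: Psi) M B -> P Psi (Lam ku A M) (Arr A ku B)) ->
  (forall Psi h As a Ms,
     head_ty Sg Psi h = Some (arrows1 As a) -> size Ms = size As ->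
     (forall i, i < size As -> pattern Sg Psi (nth_tm Ms i) (nth_ty As i)) ->
     (forall i, i < size As -> closed (nth_tm Ms i)) ->
     (forall i, i < size As -> P Psi (nth_tm Ms i) (nth_ty As i)) ->
     P Psi (spine h Ms) (Atom a)) ->
  forall Psi M A, pattern Sg Psi M A -> closed M -> P Psi M A.
Proof.
move=> Plam Pspine Psi M A; elim=> {Psi M A} [Psi A M B posA pM IH|Psi h As a Ms hh sz pMs IH|//] cM.
  by apply: Plam => //; apply: IH.
have cMs i : i < size As -> closed (nth_tm Ms i).
  by rewrite -sz; apply: closed_spine cM.
by apply: (Pspine _ _ As) => // i lti; apply: IH => //; apply: cMs.
Qed.

(** * Typing and occurrences *)

Fixpoint occ (x : nat) (M : tm) : bool :=
  match M with
  | Cst _ | Flex _ _ => false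
  | Var y => x == y
  | Lam _ _ M => occ x.+1 M
  | App M N _ => occ x M || occ x N
  end.

(** Outside this fragment occurrences do not decide typing: a [k0] argument may mention irrelevant
    parameters, and an occurrence in a [ku] argument is not a strict one. *)
Fixpoint strict_tm (M : tm) : bool :=
  match M with
  | Cst _ | Var _ => true
  | Lam ku _ M => strict_tm M
  | App M N k1 => strict_tm M && strict_tm N
  | _ => false
  end.

Definition label_ok (k : label) (b : bool) : bool :=
  match k with k1 => b | k0 => ~~ b | ku => true end.

(** The default [ku] imposes no condition, so indices beyond the end of [Phi] are harmless. *)
Definition respects (Phi : seq label) (M : tm) : Prop :=
  forall x, label_ok (nth ku Phi x) (occ x M).

Definition ctx_respects (G : lctx) (M : tm) : Prop :=
  forall x k B, onth G x = Some (k, B) -> label_ok k (occ x M).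

Lemma occ_spine x h Ms : occ x (spine h Ms) = is_var x h || has (occ x) Ms.
Proof.
elim/last_ind: Ms => [|Ms M IH]; first by case: h => //= y; rewrite orbF.
by rewrite spine_rcons /= IH has_rcons -orbA; congr (_ || _); rewrite orbC.
Qed.

Lemma strict_spine h Ms : strict_tm (spine h Ms) = all strict_tm Ms.
Proof.
elim/last_ind: Ms => [|Ms M IH]; first by case: h.
by rewrite spine_rcons /= IH all_rcons andbC.
Qed.

Lemma split_ctx_types G GM GN :
  split_ctx G GM GN -> unzip2 GM = unzip2 G /\ unzip2 GN = unzip2 G.
Proof. by elim=> //= A {}G {}GM {}GN _ [-> ->]. Qed.

Lemma split_ctx_onth G GM GN x k B :
  split_ctx G GM GN -> onth G x = Some (k, B) ->
  match k with
  | k1 => onth GM x = Some (k1, B) \/ onth GN x = Some (k1, B)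
  | k0 => onth GM x = Some (k0, B) /\ onth GN x = Some (k0, B)
  | ku => True
  end.
Proof.
move=> sG; elim: sG x => {G GM GN} [|A G GM GN _ IH|A G GM GN _ IH|A G GM GN _ IH|A G GM GN _ IH] [|x] //=;
  try (by apply: IH); move=> [<- eA]; rewrite ?eA //; by [left|right].
Qed.

(** With [p] chosen as occurrence in the function part, the strict declarations that the function
    uses go to it and the remaining ones go to the argument. *)
Lemma split_ctx_ex (p : pred nat) G : exists GM GN,
  [/\ split_ctx G GM GN,
      forall x k B, onth GM x = Some (k, B) ->
        k = ku \/ onth G x = Some (k, B) /\ (k = k1 -> p x) &
      forall x k B, onth GN x = Some (k, B) ->
        k = ku \/ onth G x = Some (k, B) /\ (k = k1 -> ~~ p x)].
Proof.
elim: G p => [|[k A] G IH] p; first by exists [::], [::]; split=> [|x k B|x k B]; rewrite ?onth0n //; constructor.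
have [GM [GN [sG pM pN]]] := IH (fun x => p x.+1).
case: k; last first.
- exists ((ku, A) :: GM), ((ku, A) :: GN).
  by split; [constructor | case=> [|x] k B /=; [case=> <-; left | apply: pM]
    | case=> [|x] k B /=; [case=> <-; left | apply: pN]].
- exists ((k0, A) :: GM), ((k0, A) :: GN).
  by split; [constructor | case=> [|x] k B /=; [case=> <- <-; right | apply: pM]
    | case=> [|x] k B /=; [case=> <- <-; right | apply: pN]].
case: (boolP (p 0)) => p0.
- exists ((k1, A) :: GM), ((ku, A) :: GN).
  by split; [constructor | case=> [|x] k B /=; [case=> <- <-; right | apply: pM]
    | case=> [|x] k B /=; [case=> <-; left | apply: pN]].
exists ((ku, A) :: GM), ((k1, A) :: GN).
by split; [constructor | case=> [|x] k B /=; [case=> <-; left | apply: pM]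
    | case=> [|x] k B /=; [case=> <- <-; right | apply: pN]].
Qed.

(** In a strict application each strict declaration stays strict in one premise, where it must
    occur, while an irrelevant one stays irrelevant in both and never reaches a variable rule. *)
Lemma typed_respects Sg G M A :
  typed Sg G M A -> strict_tm M -> ctx_respects G M.
Proof.
elim=> {G M A} [G c A _ ns|G y A Gy ns|G y A Gy un|G k A M B _ IH|//|//|
  G GM GN M N A B sG _ IHM _ IHN] /=.
- by move=> _ x [] B //= /ns.
- move=> _ x [] B //= Gx; first by case: (ns _ _ Gx).
  by apply/negP=> /eqP ex; move: Gx; rewrite ex Gy.
- move=> _ x [] B //= Gx; first by rewrite (un _ _ Gx).
  by apply/negP=> /eqP ex; move: Gx; rewrite ex Gy.
- by case: k IH => // IH sM x k B' Gx; apply: (IH sM x.+1 k B').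
move=> /andP[/IHM rM /IHN rN] x k C Gx.
have := split_ctx_onth sG Gx; case: k Gx => //= Gx.
  by case=> [/rM|/rN] /= -> //; rewrite orbT.
by case=> /rM /= /negPf -> /rN.
Qed.

(** One typing settles the types; the zones can then be changed to any that agree with the
    occurrences. *)
Lemma respects_typed Sg G0 M A :
  typed Sg G0 M A -> strict_tm M -> forall G, unzip2 G = unzip2 G0 ->
  ctx_respects G M -> typed Sg G M A.
Proof.
(* Both variable rules reduce to this: [y] occurs in itself, so its new label is not [k0], and any
   strict declaration must be that of [y]. *)
have var_case G G1 y k B : onth G1 y = Some (k, B) -> unzip2 G = unzip2 G1 ->
    ctx_respects G (Var y) -> typed Sg G (Var y) B.
  move=> Gy eG rG; have : onth (unzip2 G) y = Some B by rewrite eG onth_map Gy.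
  rewrite onth_map; case Ey: (onth G y) => [[[] C]|] //= [eC]; subst C.
  - by apply: ty_svar => // z C /rG /= /eqP.
  - by move: (rG _ _ _ Ey); rewrite /= eqxx.
  by apply: ty_uvar => // z C Ez; move: (rG _ _ _ Ez) => /= /eqP ez; move: Ez; rewrite ez Ey.
elim=> {G0 M A} [G0 c A cA _|G0 y A Gy _|G0 y A Gy _|G0 k A M B _ IH|//|//|
  G0 GM0 GN0 M N A B sG _ IHM _ IHN] /=.
- by move=> _ G _ rG; apply: ty_cst => // x B /rG.
- by move=> _ G eG; apply: var_case Gy eG.
- by move=> _ G eG; apply: var_case Gy eG.
- case: k IH => // IH sM G eG rG; apply: ty_lam; apply: IH => //=; first by rewrite eG.
  by case=> [|x] k C /=; [case=> <- | apply: rG].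
move=> /andP[sM sN] G eG rG.
(* A strict parameter occurring in [M] is consumed there, even if it also occurs in [N]; any other
   one must occur in [N]. *)
have [GM [GN [sG' pM pN]]] := split_ctx_ex (occ^~ M) G.
have [eM eN] := split_ctx_types sG'; have [eM0 eN0] := split_ctx_types sG.
apply: ty_app_1 sG' _ _.
  apply: IHM => //; first by rewrite eM eG.
  move=> x k C /pM [-> //|[Gx ok]]; move: (rG _ _ _ Gx).
  by case: k ok Gx => //= ok _; [rewrite ok | rewrite negb_or => /andP[]].
apply: IHN => //; first by rewrite eN eG.
move=> x k C /pN [-> //|[Gx ok]]; move: (rG _ _ _ Gx).
by case: k ok Gx => //= ok _; [rewrite (negPf (ok erefl)) | rewrite negb_or => /andP[]].
Qed.

Lemma closed_pattern_strict Sg Psi M A :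
  pattern Sg Psi M A -> closed M -> strict_tm M.
Proof.
move: Psi M A; apply: pattern_closed_ind => // Psi h As a Ms _ sz _ _ IH.
by rewrite strict_spine; apply/(all_nthP (Var 0)) => i; rewrite sz; apply: IH.
Qed.

Lemma split_ctx_u Psi :
  split_ctx (zip (all_u Psi) Psi) (zip (all_u Psi) Psi) (zip (all_u Psi) Psi).
Proof. by elim: Psi => /= [|B Psi IH]; constructor. Qed.

Lemma zip_onth (S T : Type) (s : seq S) (t : seq T) x : size s = size t ->
  onth (zip s t) x = if onth s x is Some a then
    if onth t x is Some b then Some (a, b) else None else None.
Proof. by elim: s t x => [|a s IH] [|b t] [|x] //= [] /IH. Qed.

Lemma all_u_onth Psi x B :
  onth Psi x = Some B -> onth (zip (all_u Psi) Psi) x = Some (ku, B).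
Proof. by elim: Psi x => [|C Psi IH] [|x] //=; [case=> -> | apply: IH]. Qed.

Lemma all_u_no_strict Psi : no_strict (zip (all_u Psi) Psi).
Proof. by elim: Psi => [|C Psi IH] [|x] B //=; apply: IH. Qed.

(** The all-unrestricted zones ask nothing of the occurrences, so this typing always exists;
    [respects_typed] then moves it to other zones. *)
Lemma closed_pattern_typed Sg Psi M A :
  pattern Sg Psi M A -> closed M -> typed Sg (zip (all_u Psi) Psi) M A.
Proof.
move: Psi M A; apply: pattern_closed_ind => [Psi A M B _ _ _ IH|Psi h As a Ms hh sz _ _ IH].
  by apply: ty_lam.
have : typed Sg (zip (all_u Psi) Psi) (head_tm h) (arrows1 As a).
  case: h hh => [c|x] /= hx; first by apply: ty_cst => //; apply: all_u_no_strict.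
  by apply: ty_uvar; [apply: all_u_onth | apply: all_u_no_strict].
(* The head is generalized to an arbitrary term, so that the arguments can be consumed from the
   left. *)
rewrite /spine; elim: As Ms (head_tm h) sz IH {hh} => [|A As IHA] [|M Ms] //= h0 [] sz IH th0.
apply: IHA => // [i lti|]; first exact: (IH i.+1).
by apply: ty_app_1 (split_ctx_u Psi) th0 _; apply: (IH 0).
Qed.

(** The bridge from typing to occurrences: the instances of flexible patterns are handled through
    [respects] from here on. *)
Lemma typed_closed_patternP Sg Psi Phi M A :
  pattern Sg Psi M A -> closed M -> size Phi = size Psi ->
  typed Sg (zip Phi Psi) M A <-> respects Phi M.
Proof.
move=> pM cM sz; have sM := closed_pattern_strict pM cM; split=> [tM x|rM].
  have [gex|ltx] := leqP (size Phi) x; first by rewrite nth_default.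
  have ltx' : x < size Psi by rewrite -sz.
  apply: (typed_respects tM sM (B := nth_ty Psi x)).
  by rewrite zip_onth // !onthE (nth_map ku) // (nth_map (Atom 0)).
apply: respects_typed (closed_pattern_typed pM cM) sM _ _ _.
  by rewrite -/(unzip2 _) !unzip2_zip ?size_nseq // sz.
move=> x k B; rewrite zip_onth //.
case Ex: (onth Phi x) => [l|] //; case: (onth Psi x) => // C [<- _].
by move: (rM x); rewrite -odflt_onth Ex.
Qed.

(** * Ground instances *)

Lemma pattern_spine Sg Psi h As a Ms :
  pattern Sg Psi (spine h Ms) (Atom a) ->
  head_ty Sg Psi h = Some (arrows1 As a) ->
  size Ms = size As /\
  forall i, i < size As -> pattern Sg Psi (nth_tm Ms i) (nth_ty As i).
Proof.
move=> pM hh; move eM: (spine h Ms) pM => M; move eA: (Atom a) => A pM.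
case: pM eM eA hh => [? ? ? ? _ _ /spine_Lam //||? ? ? ? _ _ /spine_Flex //].
move=> {}Psi h' As' a' Ms' hh' sz pMs /spine_inj[eh eM]; subst h' Ms'.
by move=> _; rewrite hh' => -[] /arrows1_inj[<- _].
Qed.

Lemma pattern_Lam Sg Psi k k' A A' M B :
  pattern Sg Psi (Lam k A M) (Arr A' k' B) -> pattern Sg (A :: Psi) M B.
Proof.
by move eN: (Lam k A M) => N; move eC: (Arr A' k' B) => C pN;
  case: pN eN eC => // {}Psi P {}N {}C _ pN [_ -> ->] [_ _ ->].
Qed.

Lemma inst_FlexP Sg Psi T E Phi a :
  pattern Sg Psi T (Atom a) -> closed T ->
  ground_inst Sg Psi T (Flex E Phi) (Atom a) <->
  size Phi = size Psi /\ respects Phi T.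
Proof.
move=> pT cT; split=> [|[sz rT]]; last first.
  by apply: inst_flex => //; apply/(typed_closed_patternP pT).
move eN: (Flex E Phi) => N; move eA: (Atom a) => A iT.
case: iT eN eA pT cT => [{}Psi E' Phi' a' {}T sz cT tT [_ ->] [->] pT _|//|? h ? ? ? Ns _ _ _ _ e].
  by split=> //; apply/(typed_closed_patternP pT).
by case: (@spine_Flex h Ns E Phi).
Qed.

Lemma inst_spine Sg Psi T h Ns As a A :
  head_ty Sg Psi h = Some (arrows1 As a) ->
  ground_inst Sg Psi T (spine h Ns) A ->
  exists Ts, [/\ T = spine h Ts, A = Atom a, size Ts = size As, size Ns = size As &
    forall i, i < size As ->
      ground_inst Sg Psi (nth_tm Ts i) (nth_tm Ns i) (nth_ty As i)].
Proof.
move=> hh; move eN: (spine h Ns) => N iT.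
case: iT eN hh => [? ? ? ? ? _ _ _ /spine_Flex //|? ? ? ? ? _ /spine_Lam //|].
move=> {}Psi h' As' a' Ts Ns' hh' szT szN iTs /spine_inj[eh eN]; subst h' Ns'.
by rewrite hh' => -[] /arrows1_inj[<- <-]; exists Ts.
Qed.

Lemma inst_of_spine Sg Psi h Ts N As a A :
  head_ty Sg Psi h = Some (arrows1 As a) ->
  ground_inst Sg Psi (spine h Ts) N A ->
  (exists E Phi, N = Flex E Phi) \/ (exists Ns, N = spine h Ns).
Proof.
move=> hh; move eT: (spine h Ts) => T iT.
case: iT eT hh => [? E Phi ? ? _ _ _ _ _|? ? ? ? ? _ /spine_Lam //|].
  by left; exists E, Phi.
by move=> {}Psi h' As' a' Ts' Ns' _ _ _ _ /spine_inj[-> _]; right; exists Ns'.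
Qed.

Lemma inst_Lam Sg Psi T k A N C :
  ground_inst Sg Psi T (Lam k A N) C ->
  exists T' B, [/\ k = ku, T = Lam ku A T', C = Arr A ku B &
    ground_inst Sg (A :: Psi) T' N B].
Proof.
move eN: (Lam k A N) => N' iT.
case: iT eN => // [{}Psi A' B T' {}N' iT [-> -> ->]|? ? ? ? ? ? _ _ _ _ e].
  by exists T', B.
by case: (@spine_Lam _ _ _ _ _ (esym e)).
Qed.

Lemma inst_of_Lam Sg Psi k A T N B :
  ground_inst Sg Psi (Lam k A T) N (Arr A ku B) ->
  exists2 N', N = Lam ku A N' & ground_inst Sg (A :: Psi) T N' B.
Proof.
move eT: (Lam k A T) => T'; move eC: (Arr A ku B) => C iT.
case: iT eT eC => // {}Psi A' B' {}T' N' iT [_ -> ->] [->].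
by exists N'.
Qed.

(** The labels [ku] added under the binders of the eta-long form constrain nothing, so the condition
    on the body is the one on [T] with indices shifted by one. *)
Lemma inst_genvarP Sg Psi T z Phi A :
  pattern Sg Psi T A -> closed T ->
  ground_inst Sg Psi T (genvar z Psi Phi A) A <->
  size Phi = size Psi /\ respects Phi T.
Proof.
elim: A Psi Phi T => [a|B _ k C IHC] Psi Phi T pT cT; first exact: inst_FlexP.
move eA: (Arr B k C) pT => A pT; case: pT eA cT => // {}Psi P {}T {}A _ pT [eB _ eC] cT; subst P A.
rewrite /=; split.
  move=> /inst_Lam[T' [C' [_ [<-] [<-]]]] /(IHC _ _ _ pT cT)[[sz] rT].
  by split=> // x; apply: (rT x.+1).
move=> [sz rT]; apply: inst_lam; apply/(IHC _ _ _ pT cT); split; first by rewrite /= sz.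
by case=> [|x] //=; apply: rT.
Qed.

Lemma respects_all_u Psi T : respects (all_u Psi) T.
Proof. by move=> x; rewrite nth_nseq if_same. Qed.

(** * Intersection *)

Lemma cap_labelC k k' : cap_label k k' = cap_label k' k.
Proof. by case: k k' => [] []. Qed.

Lemma cap_labelsC Phi1 Phi2 Phi :
  cap_labels Phi1 Phi2 Phi -> cap_labels Phi2 Phi1 Phi.
Proof.
case=> sz e; split=> //; rewrite -{}e; elim: Phi1 Phi2 sz => [|k Phi1 IH] [|k' Phi2] //= [] /IH ->.
by rewrite cap_labelC.
Qed.

(** The rules are symmetric or come in mirrored pairs; later arguments therefore treat only one
    side. *)
Lemma intersectionC Sg Psi M N Q A :
  intersection Sg Psi M N Q A -> intersection Sg Psi N M Q A.
Proof.
elim=> {Psi M N Q A}.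
- move=> Psi E1 E2 Phi1 Phi2 Phi a H sz cap; apply: cap_flex_flex (cap_labelsC cap).
  by case: cap => <-.
- by move=> Psi E Phi h As a Ms Ns H Phis sz hh szM szN dis _ IH; apply: cap_rigid_flex hh szM szN dis IH.
- by move=> Psi E Phi h As a Ms Ns H Phis sz hh szM szN dis _ IH; apply: cap_flex_rigid hh szM szN dis IH.
- by move=> Psi h As a Ms Ns Qs hh szM szN szQ _ IH; apply: cap_rigid_rigid hh szN szM szQ IH.
by move=> Psi A B M N Q _ IH; apply: cap_lam.
Qed.

Lemma cap_labels_size Phi1 Phi2 Phi :
  cap_labels Phi1 Phi2 Phi -> size Phi = size Phi1.
Proof.
by case=> sz /(congr1 size); rewrite !size_map size1_zip ?sz.
Qed.

Lemma cap_labels_nth Phi1 Phi2 Phi x : cap_labels Phi1 Phi2 Phi ->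
  cap_label (nth ku Phi1 x) (nth ku Phi2 x) = Some (nth ku Phi x).
Proof.
case; elim: Phi1 Phi2 Phi x => [|k Phi1 IH] [|k' Phi2] [|l Phi] [|x] //= [sz] [] //.
by move=> _; apply: IH.
Qed.

Lemma cap_labels_respects Phi1 Phi2 Phi T :
  cap_labels Phi1 Phi2 Phi -> respects Phi T -> respects Phi1 T.
Proof.
move=> cap rT x; move: (cap_labels_nth x cap) (rT x).
by case: (nth ku Phi1 x) (nth ku Phi2 x) => [] [] //= [<-].
Qed.

(** Label intersection fails only on [k1] against [k0], which would require a parameter both to
    occur in [T] and not to occur in it. *)
Lemma cap_labels_ex Phi1 Phi2 T :
  size Phi1 = size Phi2 -> respects Phi1 T -> respects Phi2 T ->
  exists2 Phi, cap_labels Phi1 Phi2 Phi & respects Phi T.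
Proof.
move=> sz r1 r2.
have ok x : exists2 k, cap_label (nth ku Phi1 x) (nth ku Phi2 x) = Some k & label_ok k (occ x T).
  move: (r1 x) (r2 x); case: (nth ku Phi1 x) (nth ku Phi2 x) => [] [] /=; try (by eexists);
    by [move=> ? _; eexists|move=> _ ?; eexists|move=> -> |move=> /negPf ->].
have [|Phi szP rP] := @seq_choice _ ku (size Phi1)
    (fun x k => cap_label (nth ku Phi1 x) (nth ku Phi2 x) = Some k /\ label_ok k (occ x T)).
  by move=> i _; have [k] := ok i; exists k.
exists Phi; last first.
  move=> x; have [lex|ltx] := leqP (size Phi1) x; first by rewrite nth_default ?szP.
  by case: (rP x ltx).
split=> //; apply: (@eq_from_nth _ None); rewrite size_map size1_zip ?sz // ?size_map ?szP ?sz //.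
move=> i lti; rewrite (nth_map (ku, ku)) ?size1_zip ?sz // nth_zip // (nth_map ku) ?szP ?sz //=.
by case: (rP i _) => //; rewrite sz.
Qed.

(** A parameter occurs in a spine iff it is the head or occurs in an argument. A strict one other
    than the head occurs in the argument marked [k1]; an irrelevant one is neither the head nor in
    any argument. *)
Lemma distribute_respects h n Phi Phis Ts :
  size Ts = n -> distribute h n Phi Phis ->
  (forall i, i < n -> respects (Phis i) (nth_tm Ts i)) ->
  respects Phi (spine h Ts).
Proof.
move=> szT [_ dis] rT x; have [lex|ltx] := leqP (size Phi) x; first by rewrite nth_default.
move: (dis x ltx); rewrite occ_spine; case: (nth ku Phi x) => //=.
  case=> _; case: is_varP => //= nh /(_ nh) [i [lti ei _]].
  by move: (rT i lti x); rewrite ei /= => oi; apply/(has_nthP (Var 0)); exists i; rewrite ?szT.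
case=> nh d0; case: is_varP => //= _; apply/(has_nthP (Var 0)) => -[i]; rewrite szT => lti.
by move: (rT i lti x); rewrite d0 //= => /negPf ->.
Qed.

(* A strict parameter that is not the head is given to the first argument in
   which it occurs. *)
Lemma distribute_ex h Phi Ts : respects Phi (spine h Ts) ->
  exists2 Phis, distribute h (size Ts) Phi Phis &
    forall i, i < size Ts -> respects (Phis i) (nth_tm Ts i).
Proof.
move=> rT.
pose lab i x := if nth ku Phi x is k1 then
    if is_var x h then ku else if i == find (occ x) Ts then k1 else ku
  else nth ku Phi x.
exists (fun i => mkseq (lab i) (size Phi)).
  split=> [i _|x ltx]; first by rewrite size_mkseq.
  have elab i : nth ku (mkseq (lab i) (size Phi)) x = lab i x by rewrite nth_mkseq.
  move: (rT x); rewrite occ_spine /lab in elab *.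
  case Ex: (nth ku Phi x) elab => elab /= oT; last by move=> i _; rewrite elab.
    split=> hx; first by move=> i _; rewrite elab (introT (is_varP _ _) hx).
    move: oT; have /negPf nh : ~~ is_var x h by apply/is_varP.
    rewrite nh /= has_find => lti; exists (find (occ x) Ts); split=> //.
      by rewrite elab nh eqxx.
    by move=> j _ /eqP/negPf ne; rewrite elab nh ne.
  split=> [/is_varP hx|i _]; first by rewrite hx in oT.
  by rewrite elab.
move=> i lti x; have [lex|ltx] := leqP (size Phi) x.
  by rewrite nth_default ?size_mkseq.
move: (rT x); rewrite nth_mkseq // occ_spine /lab; case: (nth ku Phi x) => //=.
  case: (is_var x h) => //=; case: eqP => //= -> hx; exact: nth_find.
by rewrite negb_or => /andP[_ /hasPn]; apply; apply: mem_nth.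
Qed.

(** In the flexible-rigid case the induction hypothesis makes each argument of [T] an instance of a
    generalized variable labelled [Phis i], and [distribute_respects] reassembles [Phi]. The
    right-hand pattern is reached through [intersectionC]. *)
Lemma intersection_sound_l Sg Psi M N Q A : intersection Sg Psi M N Q A ->
  forall T, pattern Sg Psi T A -> closed T ->
  ground_inst Sg Psi T Q A -> ground_inst Sg Psi T M A.
Proof.
elim=> {Psi M N Q A}.
- move=> Psi E1 E2 Phi1 Phi2 Phi a H sz cap T pT cT.
  move=> /(inst_FlexP _ _ pT cT)[sz' rT]; apply/(inst_FlexP _ _ pT cT).
  by split=> //; apply: cap_labels_respects cap rT.
- move=> Psi E Phi h As a Ms Ns H Phis sz hh szM szN dis _ IH T pT cT.
  move=> /(inst_spine hh)[Ts [eT _ szT _ iTs]]; apply/(inst_FlexP _ _ pT cT); subst T.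
  have [_ pTs] := pattern_spine pT hh.
  split=> //; apply: (distribute_respects szT dis) => i lti.
  have cTi : closed (nth_tm Ts i) by apply: closed_spine cT _; rewrite szT.
  by have /(inst_genvarP _ _ (pTs i lti) cTi)[] := IH i lti _ (pTs i lti) cTi (iTs i lti).
- move=> Psi E Phi h As a Ms Ns H Phis sz hh szM szN dis _ IH T pT cT.
  move=> /(inst_spine hh)[Ts [eT _ szT _ iTs]]; subst T.
  have [_ pTs] := pattern_spine pT hh.
  apply: (inst_rigid hh szT szM) => i lti; apply: IH => //; [exact: pTs | | exact: iTs].
  by apply: closed_spine cT _; rewrite szT.
- move=> Psi h As a Ms Ns Qs hh szM szN szQ _ IH T pT cT.
  move=> /(inst_spine hh)[Ts [eT _ szT _ iTs]]; subst T.
  have [_ pTs] := pattern_spine pT hh.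
  apply: (inst_rigid hh szT szM) => i lti; apply: IH => //; [exact: pTs | | exact: iTs].
  by apply: closed_spine cT _; rewrite szT.
move=> Psi A B M N Q _ IH T pT cT /inst_Lam[T' [B' [_ eT [<-] iT]]]; subst T.
by apply: inst_lam; apply: IH => //; apply: pattern_Lam pT.
Qed.

(** The induction is on the closed term [T]: its head determines which rule applies, and the
    generalized variables introduced for the arguments are not subterms of [M] or [N]. *)
Lemma intersection_complete Sg Psi T A : pattern Sg Psi T A -> closed T ->
  forall M N, ground_inst Sg Psi T M A -> ground_inst Sg Psi T N A ->
  exists2 Q, intersection Sg Psi M N Q A & ground_inst Sg Psi T Q A.
Proof.
move: Psi T A; apply: pattern_closed_ind.
  move=> Psi A T B posA pT cT IH _ _ /inst_of_Lam[M -> iM] /inst_of_Lam[N -> iN].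
  have [Q iQ iT] := IH _ _ iM iN.
  by exists (Lam ku A Q); [apply: cap_lam | apply: inst_lam].
move=> Psi h As a Ts hh szT pTs cTs IH.
have pT : pattern Sg Psi (spine h Ts) (Atom a) by apply: pat_rigid hh szT pTs.
have cT : closed (spine h Ts).
  rewrite /closed evars_spine.
  have : forall i, i < size Ts -> closed (nth_tm Ts i) by rewrite szT.
  elim: (Ts) => //= T0 Ts0 IHT c0; rewrite (c0 0 isT) /= IHT // => i lti.
  exact: (c0 i.+1).
have flex_rigid E Phi Ns : ground_inst Sg Psi (spine h Ts) (Flex E Phi) (Atom a) ->
    ground_inst Sg Psi (spine h Ts) (spine h Ns) (Atom a) ->
    exists2 Q, intersection Sg Psi (Flex E Phi) (spine h Ns) Q (Atom a)
      & ground_inst Sg Psi (spine h Ts) Q (Atom a).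
  move=> /(inst_FlexP _ _ pT cT)[szP rT].
  move=> /(inst_spine hh)[_ [/spine_inj[_ <-] _ _ szN iNs]].
  have [Phis dis rTs] := distribute_ex rT; rewrite szT in dis rTs.
  have [Qs szQ iQs] : exists2 Qs, size Qs = size As & forall i, i < size As ->
      intersection Sg Psi (genvar 0 Psi (Phis i) (nth_ty As i)) (nth_tm Ns i)
        (nth_tm Qs i) (nth_ty As i) /\
      ground_inst Sg Psi (nth_tm Ts i) (nth_tm Qs i) (nth_ty As i).
    apply: (@seq_choice _ (Var 0) _ (fun i Q => intersection Sg Psi
      (genvar 0 Psi (Phis i) (nth_ty As i)) (nth_tm Ns i) Q (nth_ty As i) /\
      ground_inst Sg Psi (nth_tm Ts i) Q (nth_ty As i))) => i lti.
    (* The labels [Phis] were distributed according to the occurrences in [Ts], so each argument is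
       an instance of its new generalized variable. The name [0] is a placeholder, made fresh
       later. *)
    have [|Q] := IH i lti (genvar 0 Psi (Phis i) (nth_ty As i)) (nth_tm Ns i) _ (iNs i lti).
      apply/(inst_genvarP _ _ (pTs i lti) (cTs i lti)); split; last exact: rTs.
      by rewrite (proj1 dis).
    by exists Q.
  exists (spine h Qs).
    by apply: (@cap_flex_rigid _ _ _ _ _ _ _ _ _ (fun=> 0) _ szP hh szN szQ dis) => i /iQs[].
  by apply: inst_rigid hh szT szQ _ => i /iQs[].
move=> M N iM iN.
case: (inst_of_spine hh iM) => [[E [Phi eM]]|[Ms eM]];
  case: (inst_of_spine hh iN) => [[E' [Phi' eN]]|[Ns eN]]; subst M N.
- move: iM iN => /(inst_FlexP _ _ pT cT)[sz rT] /(inst_FlexP _ _ pT cT)[sz' rT'].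
  have [|Phi0 cap rT0] := cap_labels_ex _ rT rT'; first by rewrite sz sz'.
  exists (genvar 0 Psi Phi0 (Atom a)); first exact: cap_flex_flex.
  by apply/(inst_genvarP _ _ pT cT); split=> //; rewrite (cap_labels_size cap).
- exact: flex_rigid.
- by have [Q /intersectionC iQ iT] := flex_rigid _ _ _ iN iM; exists Q.
move: iM => /(inst_spine hh)[_ [/spine_inj[_ <-] _ _ szM iMs]].
move: iN => /(inst_spine hh)[_ [/spine_inj[_ <-] _ _ szN iNs]].
have [Qs szQ iQs] : exists2 Qs, size Qs = size As & forall i, i < size As ->
    intersection Sg Psi (nth_tm Ms i) (nth_tm Ns i) (nth_tm Qs i) (nth_ty As i) /\
    ground_inst Sg Psi (nth_tm Ts i) (nth_tm Qs i) (nth_ty As i).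
  apply: (@seq_choice _ (Var 0) _ (fun i Q => intersection Sg Psi
    (nth_tm Ms i) (nth_tm Ns i) Q (nth_ty As i) /\
    ground_inst Sg Psi (nth_tm Ts i) Q (nth_ty As i))) => i lti.
  by have [Q] := IH i lti _ _ (iMs i lti) (iNs i lti); exists Q.
exists (spine h Qs).
  by apply: cap_rigid_rigid hh szM szN szQ _ => i /iQs[].
by apply: inst_rigid hh szT szQ _ => i /iQs[].
Qed.

(** * Complement *)

Lemma size_genvars_u Z Psi As : size (genvars_u Z Psi As) = size As.
Proof. by rewrite size_mkseq. Qed.

Lemma nth_genvars_u Z Psi As i : i < size As ->
  nth_tm (genvars_u Z Psi As) i = genvar (Z i) Psi (all_u Psi) (nth_ty As i).
Proof. by move=> lti; rewrite nth_mkseq. Qed.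

Lemma size_set_genvars_u Z Psi As i N : i < size As ->
  size (set_nth (Var 0) (genvars_u Z Psi As) i N) = size As.
Proof. by move=> lti; rewrite size_set_nth size_genvars_u; apply/maxn_idPr. Qed.

Lemma inst_genvars_u Sg Psi As Z i T : i < size As ->
  pattern Sg Psi T (nth_ty As i) -> closed T ->
  ground_inst Sg Psi T (nth_tm (genvars_u Z Psi As) i) (nth_ty As i).
Proof.
move=> lti pT cT; rewrite nth_genvars_u //; apply/(inst_genvarP _ _ pT cT).
by split; [rewrite size_nseq | apply: respects_all_u].
Qed.

Lemma nth_not_at i Phi x : nth ku (not_at i Phi) x =
  if x == i then not_label (nth ku Phi i) else ku.
Proof.
have [lex|ltx] := leqP (size Phi) x; last by rewrite nth_mkseq.
by rewrite nth_default ?size_mkseq //; case: eqP => // <-; rewrite nth_default.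
Qed.

(** Each rule leaves a single point of conflict with [M]: a negated label, a different head, or one
    argument lying in a complement. *)
Lemma complement_sound Sg Psi M Q A : complement Sg Psi M Q A ->
  forall T, pattern Sg Psi T A -> closed T ->
  ground_inst Sg Psi T Q A -> ~ ground_inst Sg Psi T M A.
Proof.
elim=> {Psi M Q A}.
- move=> Psi E Phi a i Z sz lti ne T pT cT.
  move=> /(inst_genvarP _ _ pT cT)[_ /(_ i)]; rewrite nth_not_at eqxx => nT.
  move=> /(inst_FlexP _ _ pT cT)[_ /(_ i)]; move: nT.
  by case: (nth ku Phi i) ne => //= _; case: (occ i T).
- move=> Psi A B M N _ IH T pT cT /inst_Lam[T' [B' [_ eT [<-] iT]]]; subst T.
  move=> /inst_Lam[T'' [B'' [_ [<-] [<-] iT']]].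
  by apply: IH iT iT' => //; apply: pattern_Lam pT.
- move=> Psi h g As As' a Ms Z hh sz hg ne T pT cT.
  move=> /(inst_spine hg)[Ts [-> _ _ _ _]] /(inst_spine hh)[Ts' [/spine_inj[e _] _ _ _ _]].
  exact: ne.
move=> Psi h As a Ms i N Z hh sz lti _ IH T pT cT.
move=> /(inst_spine hh)[Ts [eT _ szT _ /(_ i lti)]]; subst T.
rewrite nth_set_nth /= eqxx => iN /(inst_spine hh)[_ [/spine_inj[_ <-] _ _ _ /(_ i lti)]].
apply: IH => //; first by have [_] := pattern_spine pT hh; apply.
by apply: closed_spine cT _; rewrite szT.
Qed.

Lemma closed_pattern_Atom Sg Psi T a : pattern Sg Psi T (Atom a) -> closed T ->
  exists g Ts As, [/\ T = spine g Ts, head_ty Sg Psi g = Some (arrows1 As a),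
    size Ts = size As,
    forall i, i < size As -> pattern Sg Psi (nth_tm Ts i) (nth_ty As i) &
    forall i, i < size As -> closed (nth_tm Ts i)].
Proof.
move eA: (Atom a) => A pT cT; move: Psi T A pT cT eA.
apply: pattern_closed_ind => // Psi h As a' Ts hh sz pTs cTs _ [->].
by exists h, Ts, As.
Qed.

(** A closed term that is not an instance of [M] fails at a definite place: under a binder, at the
    head, in some argument, or at a label. The rule for that place yields [Q]. *)
Lemma complement_complete Sg Psi M A : pattern Sg Psi M A ->
  forall T, pattern Sg Psi T A -> closed T -> ~ ground_inst Sg Psi T M A ->
  exists2 Q, complement Sg Psi M Q A & ground_inst Sg Psi T Q A.
Proof.
elim=> {Psi M A}.
- move=> Psi P M B posP pM IH T0 pT.
  move eC: (Arr P ku B) pT => C pT; case: pT eC pM IH => // {}Psi P' T C' _ pT [-> ->] pM IH cT nT.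
  have [|Q cQ iT] := IH T pT cT; first by move=> iT; apply: nT; apply: inst_lam.
  by exists (Lam ku P' Q); [apply: not_lam | apply: inst_lam].
- move=> Psi h As a Ms hh sz pMs IH T pT cT nT.
  have [g [Ts [As' [eT hg szT pTs cTs]]]] := closed_pattern_Atom pT cT; subst T.
  have [egh|ne] := pselect (g = h); last first.
    exists (spine g (genvars_u id Psi As')); first exact: (not_head _ hh).
    apply: inst_rigid hg szT (size_genvars_u _ _ _) _ => i lti.
    by apply: inst_genvars_u => //; [apply: pTs | apply: cTs].
  subst g; move: (hg); rewrite hh => -[] /arrows1_inj[eAs _]; subst As'.
  have [i [lti nTi]] : exists i, i < size As /\
      ~ ground_inst Sg Psi (nth_tm Ts i) (nth_tm Ms i) (nth_ty As i).
    apply: contrapT => nex; apply: nT; apply: inst_rigid hh szT sz _ => i lti.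
    by apply: contrapT => nTi; apply: nex; exists i.
  have [Q cQ iT] := IH i lti _ (pTs i lti) (cTs i lti) nTi.
  exists (spine h (set_nth (Var 0) (genvars_u id Psi As) i Q)).
    exact: not_arg cQ.
  apply: inst_rigid hh szT (size_set_genvars_u _ _ _ lti) _ => j ltj.
  rewrite nth_set_nth /=; case: eqP => [->//|_].
  by apply: inst_genvars_u => //; [apply: pTs | apply: cTs].
move=> Psi E Phi a sz eE T pT cT nT.
(* Classically some label of [Phi] is violated by [T]; it cannot be [ku], and its negation then
   holds of [T]. *)
have [i [lti ne ok]] : exists i, [/\ i < size Phi, nth ku Phi i <> ku &
    label_ok (not_label (nth ku Phi i)) (occ i T)].
  apply: contrapT => nex; apply: nT; apply/(inst_FlexP _ _ pT cT); split=> // x.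
  have [lex|ltx] := leqP (size Phi) x; first by rewrite nth_default.
  apply: contrapT => nok; apply: nex; exists x; move: nok.
  by case: (nth ku Phi x) => //= /negP; rewrite ?negbK; split.
exists (genvar 0 Psi (not_at i Phi) (Atom a)); first exact: not_flex.
apply/(inst_genvarP _ _ pT cT); split; first by rewrite size_mkseq.
by move=> x; rewrite nth_not_at; case: eqP => // ->.
Qed.

(** * Names of existential variables *)

(** Types of existential variables are kept, because the flexible rule for patterns reads them and
    renamings preserve them. *)
Definition skel : tm -> tm := rename (fun E => (0, E.2)).

Lemma skel_spine h Ms : skel (spine h Ms) = spine h (map skel Ms).
Proof.
elim/last_ind: Ms => [|Ms M IH]; first by case: h.
by rewrite map_rcons !spine_rcons -IH.
Qed.

Lemma skel_eq_Lam Q k A M :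
  skel Q = skel (Lam k A M) -> exists2 Q', Q = Lam k A Q' & skel Q' = skel M.
Proof. by case: Q => //= k' A' Q' [-> -> e]; exists Q'. Qed.

Lemma skel_eq_Flex Q E Phi :
  skel Q = skel (Flex E Phi) -> exists2 E', Q = Flex E' Phi & E'.2 = E.2.
Proof. by case: Q => //= E' Phi' [e ->]; exists E'. Qed.

Lemma skel_eq_spine Q h Ms : skel Q = skel (spine h Ms) ->
  exists Ms', [/\ Q = spine h Ms', size Ms' = size Ms &
    forall i, skel (nth_tm Ms' i) = skel (nth_tm Ms i)].
Proof.
move=> eQ; have [Ms' -> eMs] : exists2 Ms', Q = spine h Ms' & map skel Ms' = map skel Ms.
  elim/last_ind: Ms Q eQ => [|Ms M IH] Q; last first.
    rewrite spine_rcons; case: Q => //= Q N k [/IH[Ms' -> eMs] eN ->].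
    by exists (rcons Ms' N); rewrite ?spine_rcons // !map_rcons eMs; congr rcons.
  by case: h => ? /=; case: Q => //= ? [->]; exists [::].
have szM : size Ms' = size Ms by rewrite -(size_map skel Ms') eMs size_map.
exists Ms'; split=> // i; have [lei|lti] := leqP (size Ms) i.
  by rewrite !nth_default // szM.
by rewrite -!(nth_map (Var 0) (Var 0)) ?szM // eMs.
Qed.

Lemma skel_eq_genvar Q z Psi Phi A : skel Q = skel (genvar z Psi Phi A) ->
  exists z', Q = genvar z' Psi Phi A.
Proof.
elim: A Psi Phi Q => [a|B _ k C IHC] Psi Phi Q /=.
  by move=> /skel_eq_Flex[[z' t] -> /= ->]; exists z'.
by move=> /skel_eq_Lam[Q' -> /IHC[z' ->]]; exists z'.
Qed.

Lemma skel_eq_genvars_u Z Psi As Ms : size Ms = size As ->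
  (forall i, i < size As -> skel (nth_tm Ms i) = skel (nth_tm (genvars_u Z Psi As) i)) ->
  exists Z', Ms = genvars_u Z' Psi As.
Proof.
move=> szM eM; have [|s szs Zs] := @seq_choice _ 0 (size As)
    (fun i z => nth_tm Ms i = genvar z Psi (all_u Psi) (nth_ty As i)).
  by move=> i lti; move: (eM i lti); rewrite nth_genvars_u // => /skel_eq_genvar.
exists (nth 0 s); apply: (@eq_from_nth _ (Var 0)); rewrite szM ?size_genvars_u //.
by move=> i lti; rewrite nth_genvars_u // Zs.
Qed.

Lemma ground_inst_skel Sg Psi T M A : ground_inst Sg Psi T M A ->
  forall M', skel M' = skel M -> ground_inst Sg Psi T M' A.
Proof.
elim=> {Psi T M A}.
- by move=> Psi E Phi a T sz cT tT M' /skel_eq_Flex[E' -> _]; apply: inst_flex.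
- by move=> Psi A B T M _ IH M' /skel_eq_Lam[N -> /IH]; apply: inst_lam.
move=> Psi h As a Ts Ms hh szT szM _ IH M' /skel_eq_spine[Ms' [-> sz' eM]].
by apply: inst_rigid hh szT _ _ => [|i lti]; [rewrite sz' | apply: IH].
Qed.

(** The rules leave the output names arbitrary, so a result can be freshened after it has been
    derived. *)
Lemma intersection_skel Sg Psi M N Q A : intersection Sg Psi M N Q A ->
  forall Q', skel Q' = skel Q -> intersection Sg Psi M N Q' A.
Proof.
elim=> {Psi M N Q A}.
- move=> Psi E1 E2 Phi1 Phi2 Phi a H sz cap Q' /skel_eq_genvar[H' ->].
  exact: cap_flex_flex.
- move=> Psi E Phi h As a Ms Ns H Phis sz hh szM szN dis _ IH Q' /skel_eq_spine[Ns' [-> sz' eN]].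
  by apply: cap_flex_rigid sz hh szM _ dis (fun i lti => IH i lti _ (eN i)); rewrite sz'.
- move=> Psi E Phi h As a Ms Ns H Phis sz hh szM szN dis _ IH Q' /skel_eq_spine[Ns' [-> sz' eN]].
  by apply: cap_rigid_flex sz hh szM _ dis (fun i lti => IH i lti _ (eN i)); rewrite sz'.
- move=> Psi h As a Ms Ns Qs hh szM szN szQ _ IH Q' /skel_eq_spine[Qs' [-> sz' eQ]].
  by apply: cap_rigid_rigid hh szM szN _ (fun i lti => IH i lti _ (eQ i)); rewrite sz'.
by move=> Psi A B M N Q _ IH Q' /skel_eq_Lam[Q0 -> /IH]; apply: cap_lam.
Qed.

Lemma complement_skel Sg Psi M Q A : complement Sg Psi M Q A ->
  forall Q', skel Q' = skel Q -> complement Sg Psi M Q' A.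
Proof.
elim=> {Psi M Q A}.
- by move=> Psi E Phi a i Z sz lti ne Q' /skel_eq_genvar[Z' ->]; apply: not_flex.
- by move=> Psi A B M N _ IH Q' /skel_eq_Lam[N' -> /IH]; apply: not_lam.
- move=> Psi h g As As' a Ms Z hh sz hg ne Q' /skel_eq_spine[Ns [-> szN eN]].
  have [|Z' ->] := skel_eq_genvars_u _ (fun i _ => eN i); first by rewrite szN size_genvars_u.
  exact: not_head hh sz hg ne.
move=> Psi h As a Ms i N Z hh sz lti _ IH Q' /skel_eq_spine[Ns [-> szN eN]].
rewrite size_set_genvars_u // in szN.
(* Overwriting entry [i] gives the whole list the shape of [genvars_u], from which the other names
   are read off; the original entry is then put back. *)
pose Gs := set_nth (Var 0) Ns i (genvar 0 Psi (all_u Psi) (nth_ty As i)).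
have szG : size Gs = size As by rewrite size_set_nth szN; apply/maxn_idPr.
have [|j ltj|Z' eZ] := @skel_eq_genvars_u (fun j => if j == i then 0 else Z j) Psi As Gs.
- by [].
- rewrite nth_genvars_u // /Gs nth_set_nth /=; case: eqP => [->|ne]; first by [].
  by rewrite eN nth_set_nth /= (introF eqP ne) nth_genvars_u.
have -> : Ns = set_nth (Var 0) (genvars_u Z' Psi As) i (nth_tm Ns i).
  rewrite -eZ; apply: (@eq_from_nth _ (Var 0)); first by rewrite size_set_nth szG szN; apply/esym/maxn_idPr.
  by move=> j _; rewrite /Gs !nth_set_nth /= nth_set_nth /=; case: eqP => [->|].
by apply: not_arg hh sz lti _; apply: IH; rewrite eN nth_set_nth /= eqxx.
Qed.

(** * Fresh names and renamings *)

Lemma evars_bound (M : tm) : exists k, all (fun E : exvar => E.1 < k) (evars M).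
Proof.
elim: (evars M) => [|E s [k sk]]; first by exists 0.
exists (maxn E.1.+1 k) => /=; rewrite leq_max leqnn /=.
by apply: sub_all sk => F ltF; rewrite leq_max ltF orbT.
Qed.

Lemma apart_bound Q M k :
  all (fun E : exvar => k <= E.1) (evars Q) ->
  all (fun E : exvar => E.1 < k) (evars M) -> apart Q M.
Proof.
move=> /allP geQ /allP ltM; apply/hasPn => E /ltM ltE; apply/negP => /geQ.
by rewrite leqNgt ltE.
Qed.

(** The threshold [k] varies in the induction: in an application the right part is refreshed above
    all names chosen on the left, which gives linearity. *)
Lemma refresh_ex Q k : exists Q',
  [/\ skel Q' = skel Q, linear_tm Q' & all (fun E : exvar => k <= E.1) (evars Q')].
Proof.
elim: Q k => [c|x|l A Q IH|M IHM N IHN l|E Phi] k.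
- by exists (Cst c).
- by exists (Var x).
- by have [Q' [e lQ geQ]] := IH k; exists (Lam l A Q'); split=> //=; rewrite [LHS]/skel /= -/skel e.
- have [M' [eM lM geM]] := IHM k; have [j ltj] := evars_bound M'.
  have [N' [eN lN geN]] := IHN (maxn k j).
  exists (App M' N' l); split; first by rewrite /skel /= -/skel eM eN.
    rewrite /linear_tm /= cat_uniq (lM : uniq _) (lN : uniq _) andbT /=.
    apply/hasPn => E /(allP geN); rewrite geq_max => /andP[_ leE].
    by apply/negP => /(allP ltj); rewrite ltnNge leE.
  rewrite /= all_cat geM /=; apply: sub_all geN => E.
  by rewrite geq_max => /andP[].
by exists (Flex (k, E.2) Phi); split=> //=; rewrite leqnn.
Qed.

Lemma renaming_skel M N : renaming M N -> skel N = skel M.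
Proof.
case=> r [r2 _ ->]; rewrite /skel; elim: M => //= [k A M ->|M -> N' ->|E Phi] //.
by rewrite r2.
Qed.

Lemma renaming_refl M : renaming M M.
Proof. by exists id; split=> //; elim: M => //= [k A M <-|M <- N' <-]. Qed.

Lemma apart_renaming_ex M N : exists2 N', renaming N N' & apart M N'.
Proof.
have [k ltk] := evars_bound M; pose r (E : exvar) : exvar := (E.1 + k, E.2).
exists (rename r N).
  by exists r; split=> // [[a t] [b u]] _ _ [/addIn -> ->].
have eN : evars (rename r N) = map r (evars N).
  by elim: N => //= M' -> N' -> _; rewrite map_cat.
rewrite /apart eN; apply/hasPn => _ /mapP[E _ ->].
by apply/negP => /(allP ltk); rewrite /= ltnNge leq_addl.
Qed.

Lemma skel_size_evars M M' : skel M' = skel M -> size (evars M') = size (evars M).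
Proof.
elim: M M' => [c|x|l A M IH|M IHM N IHN l|E Phi] [] //=.
- by move=> l' A' M' [_ _ /IH].
- by move=> M' N' l' [/IHM eM /IHN eN _]; rewrite !size_cat eM eN.
Qed.

Lemma skel_types M M' : skel M' = skel M -> map snd (evars M') = map snd (evars M).
Proof.
elim: M M' => [c|x|l A M IH|M IHM N IHN l|E Phi] [] //=.
- by move=> l' A' M' [_ _ /IH].
- by move=> M' N' l' [/IHM eM /IHN eN _]; rewrite !map_cat eM eN.
by move=> E' Phi' [-> _].
Qed.

(** Match the existential variables position by position: linearity of [M] makes this a function,
    linearity of [M'] makes it injective, and equal skeletons make it preserve types. *)
Lemma linear_skel_renaming M M' :
  linear_tm M -> linear_tm M' -> skel M' = skel M -> renaming M M'.
Proof.
move=> lM lM' eM; have sz := skel_size_evars eM.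
(* Outside [evars M] the index is out of range and the default [E] makes [r] the identity, so types
   are preserved there too. *)
pose r E := nth E (evars M') (index E (evars M)).
exists r; split.
- move=> E; rewrite /r; have [inE|ninE] := boolP (E \in evars M); last first.
    by rewrite nth_default // sz leqNgt index_mem.
  rewrite -(nth_map _ E.2) ?sz ?index_mem // (skel_types eM).
  by rewrite (nth_map E) ?index_mem // nth_index.
- move=> E F inE inF; rewrite /r (@set_nth_default _ _ F E) ?sz ?index_mem // => /eqP.
  rewrite nth_uniq ?sz ?index_mem // => /eqP e.
  by rewrite -(nth_index E inE) e nth_index.
have : all (fun p => r p.1 == p.2) (zip (evars M) (evars M')).
  apply/(all_nthP ((0, Atom 0), (0, Atom 0))) => i.
  rewrite size1_zip ?sz // => lti; rewrite nth_zip //= /r index_uniq //.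
  by apply/eqP; apply: set_nth_default; rewrite sz.
(* Only the positionwise matching is kept; unlike linearity and the definition of [r], it splits
   along the two parts of an application. *)
move: (r) => {r lM lM' sz} r.
elim: M M' eM => [c|x|l A M IH|M IHM N IHN l|E Phi] [] //=.
- by move=> l' A' M' [-> -> /IH e] /e ->.
- move=> M' N' l' [eM eN ->]; rewrite zip_cat ?(skel_size_evars eM) // all_cat.
  by move=> /andP[/(IHM _ eM) -> /(IHN _ eN) ->].
by move=> E' Phi' [_ ->]; rewrite andbT => /eqP ->.
Qed.

(** * Semantics of the operations on sets *)

Lemma ground_pat_cap Sg Psi A MM NN :
  ground Sg Psi A (pat_cap Sg Psi A MM NN) =
  ground Sg Psi A MM `&` ground Sg Psi A NN.
Proof.
apply/seteqP; split=> T.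
  move=> [cT pT [Q [M MM_M [N NN_N [M' [N' [[rM rN _] [iQ _ _ _]]]]]] iT]].
  by split; split=> //; [exists M | exists N] => //;
    [apply: ground_inst_skel (esym (renaming_skel rM)) |
     apply: ground_inst_skel (esym (renaming_skel rN))];
    [apply: intersection_sound_l iQ _ pT cT iT |
     apply: intersection_sound_l (intersectionC iQ) _ pT cT iT].
move=> [[cT pT [M MM_M iM]] [_ _ [N NN_N iN]]]; split=> //.
(* It suffices to rename [N]; the result is then refreshed above the names of both patterns. Neither
   change affects ground instances. *)
have [N' rN aN] := apart_renaming_ex M N.
have iN' := ground_inst_skel iN (renaming_skel rN).
have [Q0 iQ0 iT0] := intersection_complete pT cT iM iN'.
have [k1 lt1] := evars_bound M; have [k2 lt2] := evars_bound N'.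
have [Q [eQ lQ geQ]] := refresh_ex Q0 (maxn k1 k2).
exists Q; last exact: ground_inst_skel iT0 _ eQ.
exists M => //; exists N => //; exists M, N'; split; split=> //.
- exact: renaming_refl.
- exact: intersection_skel iQ0 _ eQ.
- by apply: apart_bound lt1; apply: sub_all geQ => E; rewrite geq_max => /andP[].
- by apply: apart_bound lt2; apply: sub_all geQ => E; rewrite geq_max => /andP[].
Qed.

Lemma ground_Not_pat Sg Psi A M T : pattern Sg Psi M A ->
  ground Sg Psi A (Not_pat Sg Psi A M) T <->
  [/\ closed T, pattern Sg Psi T A & ~ ground_inst Sg Psi T M A].
Proof.
move=> pM; split=> [[cT pT [Q [cQ _ _] iT]]|[cT pT nT]].
  by split=> //; apply: complement_sound cQ _ pT cT iT.
have [Q0 cQ0 iT0] := complement_complete pM pT cT nT.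
have [k ltk] := evars_bound M; have [Q [eQ lQ geQ]] := refresh_ex Q0 k.
split=> //; exists Q; last exact: ground_inst_skel iT0 _ eQ.
by split=> //; [apply: complement_skel cQ0 _ eQ | apply: apart_bound geQ ltk].
Qed.

Lemma ground_pat_one Sg Psi A T :
  ground Sg Psi A (pat_one Psi A) T <-> closed T /\ pattern Sg Psi T A.
Proof.
split=> [[]|[cT pT]] //; split=> //; exists (genvar 0 Psi (all_u Psi) A) => //.
apply/(inst_genvarP _ _ pT cT).
by split; [rewrite size_nseq | apply: respects_all_u].
Qed.

(** Finiteness of [MM] makes the chosen enumeration genuine rather than the default [[::]]. It
    covers [MM] only up to renaming, which ground instances do not see. *)
Lemma ground_pat_Not Sg Psi A MM : Pat Sg Psi A MM ->
  ground Sg Psi A (pat_Not Sg Psi A MM) =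
  [set T | [/\ closed T, pattern Sg Psi T A & ~ ground Sg Psi A MM T]].
Proof.
move=> [patM enumM]; have [sub sup] : enumerates (enumeration MM) MM by apply: xgetPex enumM.
(* Stated for any list drawn from [MM], so that the iterated intersection can be unfolded by
   induction. *)
have big_ground s : (forall M, M \in s -> MM M) -> forall T,
    ground Sg Psi A (\big[pat_cap Sg Psi A/pat_one Psi A]_(M <- s) Not_pat Sg Psi A M) T <->
    [/\ closed T, pattern Sg Psi T A & forall M, M \in s -> ~ ground_inst Sg Psi T M A].
  elim: s => [|M s IH] subs T.
    by rewrite big_nil ground_pat_one; split=> [[]|[]].
  rewrite big_cons ground_pat_cap.
  have pM : pattern Sg Psi M A by case: (patM M) => //; apply: subs; rewrite mem_head.
  have {}IH := IH (fun N inN => subs N (mem_behead (s := M :: s) inN)) T.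
  split=> [[/(ground_Not_pat _ pM)[cT pT nT] /IH[_ _ nTs]]|[cT pT nTs]].
    by split=> // N; rewrite inE => /orP[/eqP ->|/nTs].
  split; first by apply/(ground_Not_pat _ pM); split=> //; apply: nTs; rewrite mem_head.
  by apply/IH; split=> // N inN; apply: nTs; rewrite inE inN orbT.
apply/seteqP; split=> T /=.
  move=> /(big_ground _ sub)[cT pT nT]; split=> // -[_ _ [M /sup[N inN rN] iT]].
  by apply: (nT N inN); apply: ground_inst_skel iT _ (esym (renaming_skel rN)).
move=> [cT pT nT]; apply/(big_ground _ sub); split=> // M /sub inM iT.
by apply: nT; split=> //; exists M.
Qed.

(** * Finiteness *)

(* Abstractions are not counted: then generalized variables have depth 0 at
   every type, and the complement raises the depth by at most one. *)
Fixpoint depth (M : tm) : nat :=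
  match M with
  | Cst _ | Var _ | Flex _ _ => 0
  | Lam _ _ M => depth M
  | App M N _ => maxn (depth M) (depth N).+1
  end.

Lemma depth_spine h Ms d :
  (depth (spine h Ms) <= d) = all (fun M => depth M < d) Ms.
Proof.
elim/last_ind: Ms => [|Ms M IH]; first by case: h.
by rewrite spine_rcons /= geq_max IH all_rcons andbC.
Qed.

Lemma depth_spineP h Ms d :
  reflect (forall i, i < size Ms -> depth (nth_tm Ms i) < d) (depth (spine h Ms) <= d).
Proof. by rewrite depth_spine; apply: (iffP (all_nthP (Var 0))). Qed.

Lemma depth_genvar z Psi Phi A : depth (genvar z Psi Phi A) = 0.
Proof. by elim: A Psi Phi => //= B _ k C IHC Psi Phi. Qed.

Lemma depth_skel M : depth (skel M) = depth M.
Proof. by rewrite /skel; elim: M => //= M -> N ->. Qed.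

(** A flexible side contributes nothing: the generalized variables that replace it in the arguments
    have depth 0. *)
Lemma depth_intersection Sg Psi M N Q A : intersection Sg Psi M N Q A ->
  depth Q <= maxn (depth M) (depth N).
Proof.
elim=> {Psi M N Q A} //.
- move=> Psi E Phi h As a Ms Ns H Phis sz hh szM szN dis _ IH.
  rewrite max0n; apply/depth_spineP => i; rewrite szN => lti.
  apply: leq_ltn_trans (IH i lti) _; rewrite depth_genvar max0n.
  by move: (leqnn (depth (spine h Ms))) => /depth_spineP; apply; rewrite szM.
- move=> Psi E Phi h As a Ms Ns H Phis sz hh szM szN dis _ IH.
  rewrite maxn0; apply/depth_spineP => i; rewrite szN => lti.
  apply: leq_ltn_trans (IH i lti) _; rewrite depth_genvar maxn0.
  by move: (leqnn (depth (spine h Ms))) => /depth_spineP; apply; rewrite szM.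
move=> Psi h As a Ms Ns Qs hh szM szN szQ _ IH.
apply/depth_spineP => i; rewrite szQ => lti.
apply: leq_ltn_trans (IH i lti) _; rewrite gtn_max.
have /depth_spineP ltM := leq_maxl (depth (spine h Ms)) (depth (spine h Ns)).
have /depth_spineP ltN := leq_maxr (depth (spine h Ms)) (depth (spine h Ns)).
by rewrite ltM ?ltN ?szM ?szN.
Qed.

(** The extra unit is needed when [M] is a bare head and the new head takes arguments. *)
Lemma depth_complement Sg Psi M Q A : complement Sg Psi M Q A ->
  depth Q <= (depth M).+1.
Proof.
elim=> {Psi M Q A} //.
- move=> Psi h g As As' a Ms Z hh sz hg ne; apply/depth_spineP => i.
  by rewrite size_genvars_u => lti; rewrite nth_genvars_u // depth_genvar.
move=> Psi h As a Ms i N Z hh sz lti _ IH; apply/depth_spineP => j.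
rewrite size_set_genvars_u // => ltj; rewrite nth_set_nth /=; case: eqP => _; last first.
  by rewrite nth_genvars_u // depth_genvar.
apply: leq_ltn_trans IH _; rewrite ltnS.
by move: (leqnn (depth (spine h Ms))) => /depth_spineP; apply; rewrite sz.
Qed.

Definition finitely_many_skels (R : tm -> Prop) : Prop :=
  exists s : seq tm, forall M, R M -> skel M \in s.

Lemma finitely_many_skels_ord n (R : nat -> tm -> Prop) :
  (forall i, finitely_many_skels (R i)) ->
  finitely_many_skels (fun M => exists2 i, i < n & R i M).
Proof.
move=> finR; elim: n => [|n [s sP]]; first by exists [::] => M [].
have [t tP] := finR n; exists (s ++ t) => M [i]; rewrite ltnS leq_eqVlt mem_cat.
case/predU1P=> [->|lti] RM; first by rewrite tP ?orbT.
by rewrite sP //; exists i.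
Qed.

(** An arbitrary [f] lets the induction absorb the first label into the function. *)
Lemma finite_labels n (f : seq label -> tm) :
  exists s : seq tm, forall Phi, size Phi = n -> f Phi \in s.
Proof.
elim: n f => [|n IH] f; first by exists [:: f [::]] => -[] //; rewrite mem_head.
have [s1 P1] := IH (f \o cons k1); have [s0 P0] := IH (f \o cons k0).
have [su Pu] := IH (f \o cons ku); exists (s1 ++ s0 ++ su) => -[//|k Phi] [sz].
rewrite !mem_cat; case: k.
- by rewrite (P1 Phi sz : f (k1 :: Phi) \in s1).
- by rewrite (P0 Phi sz : f (k0 :: Phi) \in s0) orbT.
- by rewrite (Pu Phi sz : f (ku :: Phi) \in su) !orbT.
Qed.

Lemma finite_args n (R : nat -> tm -> Prop) :
  (forall i, finitely_many_skels (R i)) ->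
  exists s : seq (seq tm), forall Ms, size Ms = n -> (forall i, i < n -> R i (nth_tm Ms i)) ->
    map skel Ms \in s.
Proof.
elim: n R => [|n IH] R finR; first by exists [:: [::]] => -[].
have [s sP] := IH (fun i => R i.+1) (fun i => finR i.+1); have [t tP] := finR 0.
exists (allpairs cons t s) => -[//|M Ms] [sz] RM /=.
apply: allpairs_f; first exact: tP (RM 0 isT).
by apply: sP => // i lti; apply: (RM i.+1).
Qed.

(** The outer induction on depth handles the arguments of a head; the inner one on the type handles
    abstractions, which do not increase depth. At an atomic type there are finitely many heads and
    label sequences. *)
Lemma finite_patterns Sg d Psi A :
  finitely_many_skels (fun M => pattern Sg Psi M A /\ depth M < d).
Proof.
elim: d Psi A => [|d IHd] Psi A; first by exists [::] => M [].
elim: A Psi => [a|B _ k C IHC] Psi; last first.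
  have [s sP] := IHC (B :: Psi); exists (map (Lam ku B) s) => M [pM].
  move eA: (Arr B k C) pM => A pM.
  case: pM eA sP => // {}Psi P N C' _ pN [eB _ eC] sP ltN; subst P C'.
  by apply: (map_f (Lam ku B) (x := skel N)); apply: sP.
pose rigid h M := exists Ms As, [/\ M = spine h Ms,
  head_ty Sg Psi h = Some (arrows1 As a), size Ms = size As &
  forall i, i < size As -> pattern Sg Psi (nth_tm Ms i) (nth_ty As i) /\ depth (nth_tm Ms i) < d].
have fin_rigid h : finitely_many_skels (rigid h).
  (* The head determines its argument types; a head whose type does not end in [a] contributes no
     pattern. *)
  have [[As hh]|nh] := pselect (exists As, head_ty Sg Psi h = Some (arrows1 As a)); last first.
    by exists [::] => M [Ms [As [_ hh _ _]]]; case: nh; exists As.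
  have [s sP] := finite_args (size As) (fun i => IHd Psi (nth_ty As i)).
  exists (map (spine h) s) => M [Ms [As' [-> hh' sz RM]]].
  move: hh'; rewrite hh => -[] /arrows1_inj[eAs _]; subst As'.
  by rewrite skel_spine; apply: map_f; apply: sP.
have [s1 P1] := finitely_many_skels_ord (size Sg) (fun c => fin_rigid (HCst c)).
have [s2 P2] := finitely_many_skels_ord (size Psi) (fun x => fin_rigid (HVar x)).
have [s3 P3] := finite_labels (size Psi) (fun Phi => Flex (0, flex_ty Psi Phi a) Phi).
exists (s1 ++ s2 ++ s3) => M [pM ltM]; rewrite !mem_cat.
suff [rM|[rM|[E [Phi [-> sz e]]]]] : (exists2 c, c < size Sg & rigid (HCst c) M) \/
    (exists2 x, x < size Psi & rigid (HVar x) M) \/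
    exists E Phi, [/\ M = Flex E Phi, size Phi = size Psi & E.2 = flex_ty Psi Phi a].
- by rewrite P1.
- by rewrite P2 ?orbT.
- by rewrite /skel /= e P3 ?orbT.
move eA: (Atom a) pM => A pM.
case: pM eA @rigid ltM {IHd fin_rigid s1 P1 s2 P2 s3 P3} => //; last first.
  by move=> {}Psi E Phi a' sz e [->] rigid _; right; right; exists E, Phi.
move=> {}Psi h As a' Ms hh sz pMs [ea] rigid; subst a'; rewrite ltnS => /depth_spineP dMs.
have rM : rigid h (spine h Ms).
  exists Ms, As; split=> // i lti; split; first exact: pMs.
  by apply: dMs; rewrite sz.
case: h hh rM {dMs} => [c|x] /= hh rM; [left; exists c | right; left; exists x] => //.
  by rewrite -onthTE hh.
by rewrite -onthTE hh.
Qed.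

(** * From bounded depth to finiteness up to renaming *)

Definition depth_bounded (MM : set tm) : Prop := exists d, forall M, MM M -> depth M < d.

Lemma Pat_depth_bounded Sg Psi A MM : Pat Sg Psi A MM -> depth_bounded MM.
Proof.
case=> _ [s [_ sup]].
have [d dP] : exists d, forall N, N \in s -> depth N < d.
  elim: s {sup} => [|N s [d dP]]; first by exists 0.
  exists (maxn (depth N).+1 d) => N'; rewrite inE leq_max => /predU1P[->|/dP ->].
    by rewrite leqnn.
  by rewrite orbT.
exists d => M /sup[N /dP ltN /renaming_skel eN].
by rewrite -depth_skel eN depth_skel.
Qed.

(** One member of [MM] is chosen for each skeleton realized in it; by linearity every other member
    with that skeleton is a renaming of the chosen one. *)
Lemma depth_bounded_Pat Sg Psi A MM : depth_bounded MM ->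
  (forall M, MM M -> pattern Sg Psi M A /\ linear_tm M) -> Pat Sg Psi A MM.
Proof.
move=> [d dP] pM; split=> //; have [s sP] := finite_patterns Sg d Psi A.
have [t [tM tS]] : exists t : seq tm, (forall M, M \in t -> MM M) /\
    forall M, MM M -> skel M \in s -> exists2 N, N \in t & skel N = skel M.
  elim: s {sP} => [|S s [t [tM tS]]]; first by exists [::].
  have [[M MM_M eS]|nS] := pselect (exists2 M, MM M & skel M = S).
    exists (M :: t); split=> [N|N MM_N]; rewrite inE; first by case/predU1P=> [->|/tM].
    case/predU1P=> [eN|/(tS _ MM_N)[N' inN' eN']]; first by exists M; rewrite ?mem_head ?eS.
    by exists N' => //; rewrite inE inN' orbT.
  exists t; split=> // M MM_M; rewrite inE => /predU1P[eM|]; last exact: tS.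
  by case: nS; exists M.
exists t; split=> // M MM_M; have [patM linM] := pM M MM_M.
have [N inN eN] := tS M MM_M (sP M (conj patM (dP M MM_M))).
exists N => //; apply: linear_skel_renaming => //.
by have [_] := pM N (tM N inN).
Qed.

(** * The algebra of patterns *)

Lemma positive_args As a :
  positive (arrows1 As a) -> forall i, i < size As -> negative (nth_ty As i).
Proof. by elim: As => //= A As IH /andP[nA /IH nAs] [|i] //; apply: nAs. Qed.

(** Generalized variables are introduced at the argument types of heads, and their eta-long forms
    are patterns because these types are negative. *)
Lemma head_args_negative Sg Psi h As a : all positive Sg -> all positive Psi ->
  head_ty Sg Psi h = Some (arrows1 As a) ->
  forall i, i < size As -> negative (nth_ty As i).
Proof.
have onthP (s : seq ty) x B : all positive s -> onth s x = Some B -> positive B.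
  by elim: s x => [|C s IH] [|x] //= /andP[pC ps]; [case=> <- | apply: IH].
by move=> pSg pPsi hh; apply: (@positive_args As a); case: h hh => [c|x]; apply: onthP.
Qed.

Lemma pattern_genvar Sg Psi z Phi A :
  negative A -> size Phi = size Psi -> pattern Sg Psi (genvar z Psi Phi A) A.
Proof.
elim: A Psi Phi => [a|B _ k C IHC] Psi Phi /=; first by move=> _ sz; apply: pat_flex.
by case: k => // /andP[pB nC] sz; apply: pat_lam => //; apply: IHC => //=; rewrite sz.
Qed.

Lemma pattern_intersection Sg Psi M N Q A : intersection Sg Psi M N Q A ->
  all positive Sg -> all positive Psi -> negative A -> pattern Sg Psi Q A.
Proof.
move=> iQ pSg; elim: iQ => {Psi M N Q A}.
- move=> Psi E1 E2 Phi1 Phi2 Phi a H sz cap _ _.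
  by apply: pattern_genvar => //; rewrite (cap_labels_size cap).
- move=> Psi E Phi h As a Ms Ns H Phis sz hh szM szN dis _ IH pPsi _.
  by apply: (pat_rigid hh szN) => i lti; apply: IH => //; apply: head_args_negative hh _ lti.
- move=> Psi E Phi h As a Ms Ns H Phis sz hh szM szN dis _ IH pPsi _.
  by apply: (pat_rigid hh szN) => i lti; apply: IH => //; apply: head_args_negative hh _ lti.
- move=> Psi h As a Ms Ns Qs hh szM szN szQ _ IH pPsi _.
  by apply: (pat_rigid hh szQ) => i lti; apply: IH => //; apply: head_args_negative hh _ lti.
move=> Psi A B M N Q _ IH pPsi /= /andP[pA nB].
by apply: pat_lam => //; apply: IH => //=; rewrite pA.
Qed.

Lemma pattern_complement Sg Psi M Q A : complement Sg Psi M Q A ->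
  all positive Sg -> all positive Psi -> negative A -> pattern Sg Psi Q A.
Proof.
move=> cQ pSg; elim: cQ => {Psi M Q A}.
- move=> Psi E Phi a i Z sz lti ne _ _.
  by apply: pattern_genvar => //; rewrite size_mkseq.
- move=> Psi A B M N _ IH pPsi /= /andP[pA nB].
  by apply: pat_lam => //; apply: IH => //=; rewrite pA.
- move=> Psi h g As As' a Ms Z hh sz hg ne pPsi _.
  apply: pat_rigid (hg) (size_genvars_u _ _ _) _ => i lti; rewrite nth_genvars_u //.
  by apply: pattern_genvar; [apply: head_args_negative hg _ lti | rewrite size_nseq].
move=> Psi h As a Ms i N Z hh sz lti _ IH pPsi _.
apply: pat_rigid (hh) (size_set_genvars_u _ _ _ lti) _ => j ltj.
rewrite nth_set_nth /=; case: eqP => [->|_].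
  by apply: IH => //; apply: head_args_negative hh _ lti.
rewrite nth_genvars_u //.
by apply: pattern_genvar; [apply: head_args_negative hh _ ltj | rewrite size_nseq].
Qed.

(** * Closure of the finite pattern sets under the operations *)

Section PatClosure.

Variables (Sg Psi : seq ty) (A : ty).
Hypotheses (posSg : all positive Sg) (posPsi : all positive Psi).
Hypothesis negA : negative A.

Lemma Pat_zero : Pat Sg Psi A pat_zero.
Proof. by split=> //; exists [::]; split. Qed.

Lemma Pat_one : Pat Sg Psi A (pat_one Psi A).
Proof.
apply: depth_bounded_Pat => [|_ ->]; first by exists 1 => _ ->; rewrite depth_genvar.
split; first by apply: pattern_genvar => //; rewrite size_nseq.
by rewrite /linear_tm; elim: A (Psi) (all_u Psi) => //= B _ k C IHC Psi0 Phi.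
Qed.

Lemma Pat_cap MM NN :
  Pat Sg Psi A MM -> Pat Sg Psi A NN -> Pat Sg Psi A (pat_cap Sg Psi A MM NN).
Proof.
move=> /Pat_depth_bounded[d dP] /Pat_depth_bounded[e eP].
apply: depth_bounded_Pat => [|Q [M _ [N _ [M' [N' [_ [iQ lQ _ _]]]]]]]; last first.
  by split=> //; apply: pattern_intersection iQ _ _ _.
exists (maxn d e) => Q [M /dP ltM [N /eP ltN [M' [N' [[rM rN _] [iQ _ _ _]]]]]].
apply: leq_ltn_trans (depth_intersection iQ) _.
rewrite -(depth_skel M') -(depth_skel N') (renaming_skel rM) (renaming_skel rN).
by rewrite !depth_skel gtn_max !leq_max ltM ltN orbT.
Qed.

Lemma Pat_Not_pat M : Pat Sg Psi A (Not_pat Sg Psi A M).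
Proof.
apply: depth_bounded_Pat => [|Q [cQ lQ _]]; last first.
  by split=> //; apply: pattern_complement cQ _ _ _.
by exists (depth M).+2 => Q [cQ _ _]; rewrite ltnS; apply: depth_complement cQ.
Qed.

Lemma Pat_Not MM : Pat Sg Psi A (pat_Not Sg Psi A MM).
Proof.
rewrite /pat_Not; elim: (enumeration MM) => [|M s IH]; first by rewrite big_nil; apply: Pat_one.
by rewrite big_cons; apply: Pat_cap => //; apply: Pat_Not_pat.
Qed.

End PatClosure.

Theorem theorem8p5 (Sg Psi : seq ty) (A : ty)
    (hSg : all positive Sg) (hPsi : all positive Psi) (hA : negative A)
    (M N P : set tm)
    (hM : Pat Sg Psi A M) (hN : Pat Sg Psi A N) (hP : Pat Sg Psi A P) :
  pat_equiv Sg Psi A (pat_cap Sg Psi A M M) M /\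
  pat_equiv Sg Psi A (pat_cap Sg Psi A M N) (pat_cap Sg Psi A N M) /\
  pat_equiv Sg Psi A (pat_cap Sg Psi A M (N `|` P))
    (pat_cap Sg Psi A M N `|` pat_cap Sg Psi A M P) /\
  pat_equiv Sg Psi A (pat_cap Sg Psi A M (pat_cap Sg Psi A N P))
    (pat_cap Sg Psi A (pat_cap Sg Psi A M N) P) /\
  pat_equiv Sg Psi A (pat_Not Sg Psi A (pat_Not Sg Psi A M)) M /\
  pat_equiv Sg Psi A (pat_Not Sg Psi A (pat_one Psi A)) pat_zero /\
  pat_equiv Sg Psi A (pat_Not Sg Psi A pat_zero) (pat_one Psi A).
Proof.
have groundU (MM NN : set tm) :
    ground Sg Psi A (MM `|` NN) = ground Sg Psi A MM `|` ground Sg Psi A NN.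
  apply/seteqP; split=> T.
    by move=> [cT pT [Q [inQ|inQ] iT]]; [left|right]; split=> //; exists Q.
  by move=> [|] [cT pT [Q inQ iT]]; split=> //; exists Q => //; [left|right].
rewrite /pat_equiv; split; first by rewrite ground_pat_cap setIid.
split; first by rewrite !ground_pat_cap setIC.
split; first by rewrite !(groundU, ground_pat_cap) setIUr.
split; first by rewrite !ground_pat_cap setIA.
split.
  (* [Pat_Not] makes the inner complement finite, so the outer one has its expected meaning; double
     negation finishes. *)
  rewrite ground_pat_Not ?ground_pat_Not //; last exact: Pat_Not.
  apply/seteqP; split=> T /=.
    by move=> [cT pT nT]; apply: contrapT => nM; apply: nT.
  by move=> gT; case: (gT) => cT pT _; split=> // -[].
split.
  rewrite ground_pat_Not; last exact: Pat_one.
  apply/seteqP; split=> T /=; last by case=> _ _ [].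
  by move=> [cT pT []]; apply/ground_pat_one.
rewrite ground_pat_Not; last exact: Pat_zero.
apply/seteqP; split=> T /=; first by move=> [cT pT _]; apply/ground_pat_one.
by move=> /ground_pat_one[cT pT]; split=> // -[_ _ []].
Qed.
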